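(* Let $T>0$ and $\mu\geqslant 0$. Let $\varphi:\mathbb{R}\to\mathbb{R}$ be a $C^\infty$-smooth $T$-periodic function with zero average value, $\int_0^T\varphi(s)\,ds=0$, and let $h:\mathbb{R}^3\to\mathbb{R}$, $(q,p,t)\mapsto h(q,p,t)$, be a bounded $C^\infty$-smooth function that is $T$-periodic in $t$. Suppose that for all $t\in\mathbb{R}$ $$h(\pi/2,0,t)<1,\qquad h(3\pi/2,0,t)>-1.$$ Then there exists $K$ such that for any natural number $k>K$ the system $$\dot q=p-\varphi(kt)\sin q,$$ $$\dot p=-\mu p+[\mu\sin q+p\cos q]\,\varphi(kt)-\sin q-\frac{\varphi^2(kt)}{2}\sin 2q+h(q,p,t)$$ has a $T$-periodic solution $(q(t),p(t))$ such that $q(t)\in(\pi/2,3\pi/2)$ for all $t$.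
   Context: A dot denotes the derivative with respect to $t$. A $T$-periodic solution is a solution $(q,p):\mathbb{R}\to\mathbb{R}^2$ defined for all $t$ with $q(t+T)=q(t)$ and $p(t+T)=p(t)$ for all $t$ (here $q$ is real-valued, not taken modulo $2\pi$). *)

(* Defs.v *)
From Stdlib Require Import Reals.
From Coquelicot Require Import Coquelicot.

Open Scope R_scope.

Definition periodic (T : R) (f : R -> R) : Prop :=
  forall t : R, f (t + T) = f t.

Definition smooth (f : R -> R) : Prop :=
  forall (n : nat) (x : R), ex_derive_n f n x.

Definition jointly_continuous (f : R -> R -> R -> R) : Prop :=
  forall x : R * R * R,
    continuous (fun z : R * R * R => f (fst (fst z)) (snd (fst z)) (snd z)) x.

(* All partial derivatives of order at most n, mixed ones included and in every
   order of differentiation, exist everywhere and are continuous on R^3. *)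
Fixpoint C_n3 (n : nat) (f : R -> R -> R -> R) : Prop :=
  jointly_continuous f /\
  match n with
  | O => True
  | S m =>
      (forall x y z : R,
         ex_derive (fun u => f u y z) x /\
         ex_derive (fun u => f x u z) y /\
         ex_derive (fun u => f x y u) z) /\
      C_n3 m (fun x y z => Derive (fun u => f u y z) x) /\
      C_n3 m (fun x y z => Derive (fun u => f x u z) y) /\
      C_n3 m (fun x y z => Derive (fun u => f x y u) z)
  end.

Definition smooth3 (f : R -> R -> R -> R) : Prop :=
  forall n : nat, C_n3 n f.

Definition bounded3 (f : R -> R -> R -> R) : Prop :=
  exists M : R, forall x y z : R, Rabs (f x y z) <= M.

Definition pendulum_solution (mu : R) (phi : R -> R) (h : R -> R -> R -> R)
    (k : nat) (q p : R -> R) : Prop :=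
  forall t : R,
    is_derive q t (p t - phi (INR k * t) * sin (q t)) /\
    is_derive p t
      (- mu * p t
       + (mu * sin (q t) + p t * cos (q t)) * phi (INR k * t)
       - sin (q t)
       - (phi (INR k * t)) ^ 2 / 2 * sin (2 * q t)
       + h (q t) (p t) t).

(* Main.v *)
Require Import Defs.
From Stdlib Require Import Reals Lra Lia ZArith IndefiniteDescription.
From Coquelicot Require Import Coquelicot.

Open Scope R_scope.

(** Writing p = q' + phi(k t) sin q turns the system into the single equation
q'' = - mu q' - sin q - k phi'(k t) sin q + h(q, q' + phi(k t) sin q, t),
a pendulum whose pivot vibrates with a large frequency and a small amplitude.

On average the vibration exerts no force at q = PI / 2 and q = 3 PI / 2, where the
conditions on h say that gravity wins: the constants PI / 2 and 3 PI / 2 are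
then a strict lower and a strict upper solution of the averaged periodic problem.
Adding to them the fast oscillation of size 1 / k which the vibration forces gives,
for large k, a lower and an upper solution of the true equation, both
inside the strip ([oscillating_lower_solution]; the upper solution follows from
the symmetry q -> 2 PI - q).

Since the lower solution is below the upper one, a T-periodic solution between
them exists by monotone iteration, without any fixed point theorem
([periodic_between_lower_and_upper]). For an equation q'' = F(t, q, q') with F
Lipschitz, the variables y = r q + q' and z = r q - q' satisfy
y' = r y - G, z' = - r z + G with G = r^2 q - F, and for large r the function G is
nondecreasing in y and in z. The periodic solution operators of y' = r y - g and
z' = - r z + g preserve order, so iterating them from the lower solution gives a
monotone bounded sequence whose limit is a periodic solution
([monotone_periodic_system]).

The function h is only locally Lipschitz, so h is first truncated in q and p. The
velocity of a periodic solution in the strip is bounded in terms of sup |h| only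
([periodic_velocity_bound]), so for a high enough truncation level the solution
found solves the original system. *)

(** * Periodic functions, compactness and the mean value inequality *)

Lemma periodic_IZR (T : R) (f : R -> R) (n : Z) (t : R) :
  periodic T f -> f (t + IZR n * T) = f t.
Proof.
intros Hf.
assert (Hnat : forall (m : nat) (s : R), f (s + INR m * T) = f s).
{ induction m as [|m IH]; intros s.
  - simpl; f_equal; ring.
  - rewrite S_INR, <- (IH s), <- (Hf (s + INR m * T)). f_equal; ring. }
destruct (Z_le_dec 0 n) as [Hn|Hn].
- rewrite <- (Z2Nat.id n Hn), <- INR_IZR_INZ. apply Hnat.
- rewrite <- (Hnat (Z.to_nat (- n)) (t + IZR n * T)).
  rewrite INR_IZR_INZ, Z2Nat.id, opp_IZR by lia. f_equal; ring.
Qed.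

Lemma periodic_INR (T : R) (f : R -> R) (n : nat) (t : R) :
  periodic T f -> f (t + INR n * T) = f t.
Proof. intros Hf. rewrite INR_IZR_INZ. now apply periodic_IZR. Qed.

Lemma period_reduction (T t : R) :
  0 < T -> exists n : Z, 0 <= t + IZR n * T <= T.
Proof.
intros HT. exists (1 - up (t / T))%Z.
destruct (archimed (t / T)) as [H1 H2].
rewrite minus_IZR.
assert (Ht : t = t / T * T) by (field; lra).
assert (0 <= (IZR (up (t / T)) - t / T) * T) by (apply Rmult_le_pos; lra).
assert (0 <= (1 - (IZR (up (t / T)) - t / T)) * T) by (apply Rmult_le_pos; lra).
nra.
Qed.

(** Stated with a bound that depends only on the value at the centre, so that the
radius can be shrunk until it also records that value. *)
Lemma locally_bounded3 (f : R -> R -> R -> R) (x y z : R) :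
  jointly_continuous f ->
  exists d : posreal, forall x' y' z' : R,
    Rabs (x' - x) < d -> Rabs (y' - y) < d -> Rabs (z' - z) < d ->
    Rabs (f x' y' z') < 1 + Rabs (f x y z).
Proof.
intros Hf.
destruct (proj1 (filterlim_locally _ _) (Hf (x, y, z)) (mkposreal 1 Rlt_0_1))
  as [d Hd].
exists d. intros x' y' z' Hx Hy Hz.
specialize (Hd (x', y', z')).
assert (Hb : Rabs (f x' y' z' - f x y z) < 1)
  by (apply Hd; split; [split|]; assumption).
generalize (Rabs_triang (f x' y' z' - f x y z) (f x y z)).
replace (f x' y' z' - f x y z + f x y z) with (f x' y' z') by ring. lra.
Qed.

(** Compactness of [a,b] x [c,d] x [0,T], in the form of Cousin's lemma: every
gauge has a positive lower bound along suitable tagged points. The gauge is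
chosen below 1 / (1 + |f|) at its centre, so this lower bound is at the same
time the reciprocal of a bound for f. *)
Lemma bounded_on_periodic_box (T a b c d : R) (f : R -> R -> R -> R) :
  0 < T -> jointly_continuous f -> (forall x y : R, periodic T (f x y)) ->
  exists M : R, 0 <= M /\ forall x y z : R,
    a <= x <= b -> c <= y <= d -> Rabs (f x y z) <= M.
Proof.
intros HT Hf Hper.
assert (Hdelta : forall s : Compactness.Tn 3 R, exists e : posreal,
  forall s', close_n 3 e s' s ->
    Rabs (f (fst s') (fst (snd s')) (fst (snd (snd s')))) <= / e).
{ intros [x [y [z []]]].
  destruct (locally_bounded3 f x y z Hf) as [e He].
  assert (Hpos : 0 < / (1 + Rabs (f x y z)))
    by (apply Rinv_0_lt_compat; generalize (Rabs_pos (f x y z)); lra).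
  assert (Hmin : 0 < Rmin e (/ (1 + Rabs (f x y z))))
    by (apply Rmin_glb_lt; [apply cond_pos | exact Hpos]).
  exists (mkposreal _ Hmin). intros [x' [y' [z' []]]]. simpl.
  intros [Hx [Hy [Hz _]]].
  assert (Hl := Rmin_l e (/ (1 + Rabs (f x y z)))).
  apply Rle_trans with (1 + Rabs (f x y z)).
  - left; apply He; lra.
  - rewrite <- (Rinv_inv (1 + Rabs (f x y z))) at 1.
    apply Rinv_le_contravar; [exact Hmin | apply Rmin_r]. }
apply functional_choice in Hdelta. destruct Hdelta as [delta Hdelta].
destruct (compactness_value 3 (a, (c, (0, tt))) (b, (d, (T, tt))) delta)
  as [e He].
assert (Hbox : forall x y z : R, a <= x <= b -> c <= y <= d -> 0 <= z <= T ->
  Rabs (f x y z) <= / e).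
{ intros x y z Hx Hy Hz. apply Rnot_lt_le. intros Hlt.
  apply (He (x, (y, (z, tt)))); [simpl; tauto|].
  intros [s [_ [Hs Hes]]].
  apply (Rlt_not_le _ _ Hlt). apply Rle_trans with (/ delta s).
  - apply (Hdelta s (x, (y, (z, tt))) Hs).
  - apply Rinv_le_contravar; [apply cond_pos | exact Hes]. }
exists (/ e). split.
- left. apply Rinv_0_lt_compat, cond_pos.
- intros x y z Hx Hy. destruct (period_reduction T z HT) as [n Hn].
  rewrite <- (periodic_IZR T (f x y) n z (Hper x y)). now apply Hbox.
Qed.

Lemma bounded_periodic (T : R) (f : R -> R) :
  0 < T -> (forall t : R, continuous f t) -> periodic T f ->
  exists M : R, 0 <= M /\ forall t : R, Rabs (f t) <= M.
Proof.
intros HT Hf Hper.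
destruct (bounded_on_periodic_box T 0 0 0 0 (fun _ _ z => f z) HT)
  as [M [HM Hb]].
- intros [[x y] z]. simpl.
  apply (continuous_comp (fun p : R * R * R => snd p) f); [apply continuous_snd | apply Hf].
- intros _ _. exact Hper.
- exists M. split; [exact HM|]. intros t. apply (Hb 0 0 t); lra.
Qed.

Lemma continuity_pt_of_is_derive (f : R -> R) (x l : R) :
  is_derive f x l -> continuity_pt f x.
Proof.
intros H. apply continuity_pt_filterlim.
apply (ex_derive_continuous (K := R_AbsRing) (V := R_NormedModule)).
now exists l.
Qed.

Lemma continuous_of_is_derive (f : R -> R) (x l : R) :
  is_derive f x l -> continuous f x.
Proof.
intros H. apply (ex_derive_continuous (K := R_AbsRing) (V := R_NormedModule)).
now exists l.
Qed.

Lemma mean_value (f df : R -> R) (x y : R) :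
  (forall z, Rmin x y <= z <= Rmax x y -> is_derive f z (df z)) ->
  exists c, Rmin x y <= c <= Rmax x y /\ f y - f x = df c * (y - x).
Proof.
intros H. apply MVT_gen.
- intros z Hz. apply H; lra.
- intros z Hz. apply continuity_pt_of_is_derive with (df z). now apply H.
Qed.

Lemma lipschitz_of_derive_bound (f df : R -> R) (M x y : R) :
  (forall z, Rmin x y <= z <= Rmax x y -> is_derive f z (df z)) ->
  (forall z, Rmin x y <= z <= Rmax x y -> Rabs (df z) <= M) ->
  Rabs (f y - f x) <= M * Rabs (y - x).
Proof.
intros H HM. destruct (mean_value f df x y H) as [c [Hc ->]].
rewrite Rabs_mult. apply Rmult_le_compat_r; [apply Rabs_pos | now apply HM].
Qed.

Lemma nondecreasing_of_derive (f df : R -> R) (x y : R) :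
  (forall z, is_derive f z (df z)) -> (forall z, 0 <= df z) ->
  x <= y -> f x <= f y.
Proof.
intros H H0 Hxy. destruct (mean_value f df x y) as [c [_ Hc]]; [auto|].
assert (0 <= df c * (y - x)) by (apply Rmult_le_pos; [apply H0 | lra]). lra.
Qed.

Lemma sin_lipschitz (x y : R) : Rabs (sin y - sin x) <= Rabs (y - x).
Proof.
rewrite <- (Rmult_1_l (Rabs (y - x))).
apply lipschitz_of_derive_bound with cos; intros z _.
- auto_derive; [easy | ring].
- apply Rabs_le. generalize (COS_bound z); lra.
Qed.

Definition clamp (a b x : R) : R := Rmax a (Rmin b x).

Lemma clamp_bounds (a b x : R) : a <= b -> a <= clamp a b x <= b.
Proof.
intros H. split; [apply Rmax_l|]. apply Rmax_lub; [exact H | apply Rmin_l].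
Qed.

Lemma clamp_id (a b x : R) : a <= x <= b -> clamp a b x = x.
Proof.
intros H. unfold clamp. rewrite Rmin_right by lra. apply Rmax_right; lra.
Qed.

Lemma clamp_lipschitz (a b x y : R) :
  Rabs (clamp a b y - clamp a b x) <= Rabs (y - x).
Proof.
unfold clamp, Rmax, Rmin.
repeat destruct Rle_dec; unfold Rabs; repeat destruct Rcase_abs; lra.
Qed.

(** * Periodic solutions of scalar linear equations and pointwise limits *)

Lemma continuous_RInt_derive (f : R -> R) (a t : R) :
  (forall s, continuous f s) -> is_derive (fun x => RInt f a x) t (f t).
Proof.
intros Hf. apply is_derive_RInt with a; [|apply Hf].
apply filter_forall. intros x.
apply (RInt_correct (V := R_CompleteNormedModule)).
apply (ex_RInt_continuous (V := R_CompleteNormedModule)). intros; apply Hf.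
Qed.

Lemma constant_of_derive_zero (f : R -> R) (x y : R) :
  (forall z, is_derive f z 0) -> f x = f y.
Proof.
intros H. destruct (mean_value f (fun _ => 0) x y) as [c [_ Hc]]; [auto|]. lra.
Qed.

Lemma is_derive_shift (f : R -> R) (a t l : R) :
  is_derive f (t + a) l -> is_derive (fun s => f (s + a)) t l.
Proof.
intros H. auto_derive; [now exists l|]. replace (Derive (fun x : R => f x) (t + a)) with l
  by (symmetry; apply is_derive_unique, H). ring.
Qed.

Lemma is_derive_reflect (f : R -> R) (t l : R) :
  is_derive f (- t) l -> is_derive (fun s => f (- s)) t (- l).
Proof.
intros H. auto_derive; [now exists l|]. replace (Derive (fun x : R => f x) (- t)) with l
  by (symmetry; apply is_derive_unique, H). ring.
Qed.

Lemma continuous_reflect (f : R -> R) :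
  (forall t, continuous f t) -> forall t, continuous (fun s => f (- s)) t.
Proof.
intros Hf t. apply (continuous_comp Ropp f); [|apply Hf].
apply continuous_of_is_derive with (-1). auto_derive; [easy | ring].
Qed.

Lemma periodic_reflect (T : R) (f : R -> R) :
  periodic T f -> periodic T (fun t => f (- t)).
Proof.
intros Hf t. rewrite <- (Hf (- (t + T))). f_equal. ring.
Qed.

(** The function exp (- r t) u is nonincreasing; over one period it is multiplied
by exp (- r T) < 1 while u returns to its value, which excludes u < 0. All
order relations between solutions come from this comparison principle. *)
Lemma periodic_nonneg_of_derive_le (r T : R) (u du : R -> R) :
  0 < r -> 0 < T -> periodic T u ->
  (forall t, is_derive u t (du t)) -> (forall t, du t <= r * u t) ->
  forall t, 0 <= u t.
Proof.
intros Hr HT Hper Hdu Hle t.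
assert (Hmono : - (exp (- r * t) * u t) <= - (exp (- r * (t + T)) * u (t + T))).
{ apply (nondecreasing_of_derive (fun s => - (exp (- r * s) * u s))
    (fun s => exp (- r * s) * (r * u s - du s))); [| |lra].
  - intros s. auto_derive; [now exists (du s)|].
    replace (Derive (fun x : R => u x) s) with (du s)
      by (symmetry; apply is_derive_unique, Hdu). ring.
  - intros s. apply Rmult_le_pos; [left; apply exp_pos | generalize (Hle s); lra]. }
rewrite Hper in Hmono.
assert (exp (- r * (t + T)) < exp (- r * t)) by (apply exp_increasing; nra).
nra.
Qed.

Lemma periodic_nonneg_of_derive_ge (r T : R) (u du : R -> R) :
  0 < r -> 0 < T -> periodic T u ->
  (forall t, is_derive u t (du t)) -> (forall t, - r * u t <= du t) ->
  forall t, 0 <= u t.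
Proof.
intros Hr HT Hper Hdu Hle t. rewrite <- (Ropp_involutive t).
apply (periodic_nonneg_of_derive_le r T (fun s => u (- s)) (fun s => - du (- s)));
  try assumption.
- now apply periodic_reflect.
- intros s. apply is_derive_reflect, Hdu.
- intros s. generalize (Hle (- s)); lra.
Qed.

(** The unique T-periodic solution of y' = r y - psi. The constant of integration
is the one that makes variation of constants periodic; in closed form the
solution is a positive combination of the future values of psi. *)
Definition unstable_response (r T : R) (psi : R -> R) (t : R) : R :=
  exp (r * t) * (RInt (fun s => exp (- r * s) * psi s) 0 T / (1 - exp (- r * T))
                 - RInt (fun s => exp (- r * s) * psi s) 0 t).

(** The unique T-periodic solution of z' = - r z + psi, obtained by reversing time. *)
Definition stable_response (r T : R) (psi : R -> R) (t : R) : R :=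
  unstable_response r T (fun s => psi (- s)) (- t).

Lemma unstable_response_spec (r T : R) (psi : R -> R) :
  0 < r -> 0 < T -> (forall t, continuous psi t) -> periodic T psi ->
  periodic T (unstable_response r T psi) /\
  forall t, is_derive (unstable_response r T psi) t
    (r * unstable_response r T psi t - psi t).
Proof.
intros Hr HT Hpsi Hper.
set (g := fun s => exp (- r * s) * psi s).
assert (Hg : forall s, continuous g s).
{ intros s. apply (continuous_mult (fun s => exp (- r * s)) psi); [|apply Hpsi].
  apply continuous_of_is_derive with (- r * exp (- r * s)).
  auto_derive; [easy | ring]. }
set (E := fun t => RInt g 0 t).
assert (HE : forall t, is_derive E t (g t))
  by (intros t; now apply continuous_RInt_derive).
assert (HE0 : E 0 = 0) by (unfold E; apply (RInt_point (V := R_CompleteNormedModule))).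
(* The primitive E is periodic up to the multiplier exp (- r T); solving
   C = exp (- r T) C + E T for C gives the constant in the definition. *)
assert (Hshift : forall t, E (t + T) = exp (- r * T) * E t + E T).
{ intros t.
  assert (Hc : E (t + T) - exp (- r * T) * E t = E (0 + T) - exp (- r * T) * E 0).
  { apply (constant_of_derive_zero (fun t => E (t + T) - exp (- r * T) * E t)).
    intros s.
    replace 0 with (g (s + T) - exp (- r * T) * g s).
    - apply (is_derive_minus (V := R_NormedModule)).
      + apply is_derive_shift, HE.
      + apply is_derive_scal, HE.
    - unfold g. rewrite Hper, Rmult_plus_distr_l, exp_plus. ring. }
  rewrite Rplus_0_l, HE0 in Hc. lra. }
assert (Hlt : exp (- r * T) < 1)
  by (rewrite <- exp_0; apply exp_increasing; nra).
split.
- intros t. unfold unstable_response. fold g. fold (E T) (E t) (E (t + T)).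
  rewrite Hshift, Rmult_plus_distr_l, exp_plus.
  replace (exp (- r * T)) with (/ exp (r * T)) in *
    by (rewrite <- exp_Ropp; f_equal; ring).
  assert (Hp := exp_pos (r * T)).
  assert (exp (r * T) <> 1).
  { intros H. rewrite H in Hlt. lra. }
  field. split; lra.
- intros t. unfold unstable_response. fold g. fold (E T).
  change (is_derive (fun s => exp (r * s) * (E T / (1 - exp (- r * T)) - E s)) t
    (r * (exp (r * t) * (E T / (1 - exp (- r * T)) - E t)) - psi t)).
  auto_derive; [now exists (g t)|].
  replace (Derive (fun x : R => E x) t) with (g t)
    by (symmetry; apply is_derive_unique, HE).
  replace (psi t) with (exp (r * t) * g t); [unfold Rdiv; ring|].
  unfold g. rewrite <- Rmult_assoc, <- exp_plus.
  replace (r * t + - r * t) with 0 by ring. rewrite exp_0. ring.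
Qed.

Lemma stable_response_spec (r T : R) (psi : R -> R) :
  0 < r -> 0 < T -> (forall t, continuous psi t) -> periodic T psi ->
  periodic T (stable_response r T psi) /\
  forall t, is_derive (stable_response r T psi) t
    (- r * stable_response r T psi t + psi t).
Proof.
intros Hr HT Hpsi Hper.
destruct (unstable_response_spec r T (fun s => psi (- s))) as [Hp Hd]; try assumption.
- now apply continuous_reflect.
- now apply periodic_reflect.
- split; [now apply periodic_reflect|].
  intros t. unfold stable_response.
  replace (- r * unstable_response r T (fun s => psi (- s)) (- t) + psi t)
    with (- (r * unstable_response r T (fun s => psi (- s)) (- t) - psi (- - t)))
    by (rewrite Ropp_involutive; ring).
  apply is_derive_reflect, Hd.
Qed.

Lemma is_lim_seq_bounds (u : nat -> R) (l m M : R) :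
  (forall n, m <= u n <= M) -> is_lim_seq u l -> m <= l <= M.
Proof.
intros H Hu. split.
- apply (is_lim_seq_le (fun _ => m) u m l); [apply H | apply is_lim_seq_const | exact Hu].
- apply (is_lim_seq_le u (fun _ => M) l M); [apply H | exact Hu | apply is_lim_seq_const].
Qed.

Lemma is_derive_of_quadratic_error (f : R -> R) (C t l : R) :
  (forall s, Rabs (f s - f t - (s - t) * l) <= C * (s - t) ^ 2) ->
  is_derive f t l.
Proof.
intros H. apply is_derive_Reals. intros eps Heps.
assert (HC : 0 <= C).
{ generalize (Rle_trans _ _ _ (Rabs_pos _) (H (t + 1))).
  replace (C * (t + 1 - t) ^ 2) with C by ring. easy. }
assert (Hd : 0 < eps / (C + 1)) by (apply Rdiv_lt_0_compat; lra).
exists (mkposreal _ Hd). simpl. intros h Hh Hlt.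
specialize (H (t + h)). replace (t + h - t) with h in H by ring.
replace ((f (t + h) - f t) / h - l) with ((f (t + h) - f t - h * l) / h) by (field; easy).
unfold Rdiv. rewrite Rabs_mult, Rabs_inv.
assert (Hpos : 0 < Rabs h) by now apply Rabs_pos_lt.
apply Rle_lt_trans with (C * Rabs h).
- apply Rmult_le_reg_r with (Rabs h); [easy|].
  rewrite Rmult_assoc, Rinv_l, Rmult_1_r by lra.
  rewrite Rmult_assoc, <- Rabs_mult, (Rabs_right (h * h)) by nra.
  eapply Rle_trans; [exact H|]. right; ring.
- assert (H1 : (C + 1) * Rabs h < (C + 1) * (eps / (C + 1)))
    by (apply Rmult_lt_compat_l; lra).
  replace ((C + 1) * (eps / (C + 1))) with eps in H1 by (field; lra). nra.
Qed.

(** Equi-Lipschitz derivatives make the first-order Taylor error of u n at t at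
most C (s - t)^2 for every n, and such a bound survives a pointwise limit. Hence
no uniform convergence has to be established. *)
Lemma is_derive_pointwise_limit (u du : nat -> R -> R) (ul dl : R -> R) (C : R) :
  (forall n t, is_derive (u n) t (du n t)) ->
  (forall n t s, Rabs (du n s - du n t) <= C * Rabs (s - t)) ->
  (forall t, is_lim_seq (fun n => u n t) (ul t)) ->
  (forall t, is_lim_seq (fun n => du n t) (dl t)) ->
  forall t, is_derive ul t (dl t).
Proof.
intros Hder HC Hu Hd t.
assert (HC0 : 0 <= C).
{ generalize (Rle_trans _ _ _ (Rabs_pos _) (HC O 0 1)).
  rewrite Rminus_0_r, Rabs_R1. lra. }
apply is_derive_of_quadratic_error with C. intros s.
apply Rabs_le.
apply (is_lim_seq_bounds (fun n => u n s - u n t - (s - t) * du n t)).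
- intros n. apply Rabs_le_between.
  destruct (mean_value (u n) (du n) t s) as [c [Hc ->]]; [intros; apply Hder|].
  replace (du n c * (s - t) - (s - t) * du n t) with ((du n c - du n t) * (s - t)) by ring.
  rewrite Rabs_mult.
  replace (C * (s - t) ^ 2) with (C * Rabs (s - t) * Rabs (s - t))
    by (rewrite Rmult_assoc, <- Rabs_mult, (Rabs_right ((s - t) * (s - t))) by apply Rle_ge, Rle_0_sqr; ring).
  apply Rmult_le_compat_r; [apply Rabs_pos|].
  eapply Rle_trans; [apply HC|].
  apply Rmult_le_compat_l; [exact HC0|].
  revert Hc. unfold Rmin, Rmax. destruct Rle_dec; intros Hc; apply Rabs_le_between;
    unfold Rabs; destruct Rcase_abs; lra.
- apply (is_lim_seq_minus' (fun n => u n s - u n t) (fun n => (s - t) * du n t)).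
  + now apply is_lim_seq_minus'.
  + apply (is_lim_seq_scal_l (fun n => du n t) (s - t) (dl t)). apply Hd.
Qed.

(** * Monotone iteration for a cooperative periodic system *)

Definition lipschitz3 (L : R) (f : R -> R -> R -> R) : Prop :=
  forall x x' y y' z z' : R,
    Rabs (f x' y' z' - f x y z)
    <= L * (Rabs (x' - x) + Rabs (y' - y) + Rabs (z' - z)).

Lemma lipschitz3_nonneg (L : R) (f : R -> R -> R -> R) :
  lipschitz3 L f -> 0 <= L.
Proof.
intros H. generalize (Rle_trans _ _ _ (Rabs_pos _) (H 0 1 0 0 0 0)).
rewrite !Rminus_0_r, Rabs_R0, Rabs_R1. lra.
Qed.

Lemma continuous_lipschitz3_comp (L : R) (f : R -> R -> R -> R) (y z : R -> R) (t : R) :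
  lipschitz3 L f -> continuous y t -> continuous z t ->
  continuous (fun s => f s (y s) (z s)) t.
Proof.
intros Hf Hy Hz. assert (HL := lipschitz3_nonneg L f Hf).
apply filterlim_locally. intros eps.
assert (He : 0 < eps / (3 * (L + 1)))
  by (apply Rdiv_lt_0_compat; [apply cond_pos | lra]).
assert (H1 := proj1 (filterlim_locally _ _) Hy (mkposreal _ He)).
assert (H2 := proj1 (filterlim_locally _ _) Hz (mkposreal _ He)).
assert (H3 : locally t (fun s => Rabs (s - t) < eps / (3 * (L + 1))))
  by (exists (mkposreal _ He); intros s Hs; exact Hs).
generalize (filter_and _ _ H1 (filter_and _ _ H2 H3)).
apply filter_imp. intros s [Hys [Hzs Hs]].
change (Rabs (y s - y t) < eps / (3 * (L + 1))) in Hys.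
change (Rabs (z s - z t) < eps / (3 * (L + 1))) in Hzs.
change (Rabs (f s (y s) (z s) - f t (y t) (z t)) < eps).
eapply Rle_lt_trans; [apply Hf|].
replace (pos eps) with ((L + 1) * (3 * (eps / (3 * (L + 1))))) by (field; lra).
set (e := eps / (3 * (L + 1))) in *.
generalize (Rabs_pos (s - t)) (Rabs_pos (y s - y t)) (Rabs_pos (z s - z t)). nra.
Qed.

Lemma is_lim_seq_lipschitz3_comp (L : R) (f : R -> R -> R -> R) (t : R)
  (y z : nat -> R) (yl zl : R) :
  lipschitz3 L f -> is_lim_seq y yl -> is_lim_seq z zl ->
  is_lim_seq (fun n => f t (y n) (z n)) (f t yl zl).
Proof.
intros Hf Hy Hz.
assert (Habs : forall (u : nat -> R) (l : R), is_lim_seq u l ->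
  is_lim_seq (fun n => Rabs (u n - l)) 0).
{ intros u l Hu. apply (proj1 (is_lim_seq_abs_0 _)).
  replace (Finite 0) with (Finite (l - l)) by (f_equal; ring).
  apply is_lim_seq_minus'; [exact Hu | apply is_lim_seq_const]. }
assert (Hlim : is_lim_seq (fun n => f t (y n) (z n) - f t yl zl) 0).
{ apply (proj2 (is_lim_seq_abs_0 _)).
  apply (is_lim_seq_le_le (fun _ => 0) _
    (fun n => L * (Rabs (y n - yl) + Rabs (z n - zl)))).
  - intros n. split; [apply Rabs_pos|].
    eapply Rle_trans; [apply Hf|]. rewrite Rminus_diag, Rabs_R0. right; ring.
  - apply is_lim_seq_const.
  - replace (Finite 0) with (Rbar_mult L (0 + 0)) by (simpl; f_equal; ring).
    apply is_lim_seq_scal_l. apply is_lim_seq_plus'; now apply Habs. }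
apply (is_lim_seq_ext (fun n => f t (y n) (z n) - f t yl zl + f t yl zl));
  [intros; ring|].
replace (Finite (f t yl zl)) with (Finite (0 + f t yl zl)) by (f_equal; ring).
apply is_lim_seq_plus'; [exact Hlim | apply is_lim_seq_const].
Qed.

Definition periodic_pair (T : R) (s : (R -> R) * (R -> R)) : Prop :=
  periodic T (fst s) /\ periodic T (snd s) /\
  (forall t, continuous (fst s) t) /\ (forall t, continuous (snd s) t).

Definition pair_le (s s' : (R -> R) * (R -> R)) : Prop :=
  forall t : R, fst s t <= fst s' t /\ snd s t <= snd s' t.

(** The system under study is y' = r y - G t y z, z' = - r z + G t y z, with the same
nonlinearity G in both equations; s is the pair (y, z). *)
Definition forcing (G : R -> R -> R -> R) (s : (R -> R) * (R -> R)) (t : R) : R :=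
  G t (fst s t) (snd s t).

(** A pair is a periodic solution of the system exactly when it is a fixed point of
this operator. *)
Definition response (r T : R) (G : R -> R -> R -> R) (s : (R -> R) * (R -> R)) :
  (R -> R) * (R -> R) :=
  (unstable_response r T (forcing G s), stable_response r T (forcing G s)).

Lemma response_spec (r T L : R) (G : R -> R -> R -> R) (s : (R -> R) * (R -> R)) :
  0 < r -> 0 < T -> lipschitz3 L G ->
  (forall t y z, G (t + T) y z = G t y z) -> periodic_pair T s ->
  periodic_pair T (response r T G s) /\
  forall t,
    is_derive (fst (response r T G s)) t
      (r * fst (response r T G s) t - forcing G s t) /\
    is_derive (snd (response r T G s)) t
      (- r * snd (response r T G s) t + forcing G s t).
Proof.
intros Hr HT HG Hper [Hp1 [Hp2 [Hc1 Hc2]]].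
assert (Hc : forall t, continuous (forcing G s) t)
  by (intros t; now apply continuous_lipschitz3_comp with L).
assert (Hp : periodic T (forcing G s))
  by (intros t; unfold forcing; rewrite Hper, Hp1, Hp2; reflexivity).
destruct (unstable_response_spec r T _ Hr HT Hc Hp) as [Hu1 Hu2].
destruct (stable_response_spec r T _ Hr HT Hc Hp) as [Hs1 Hs2].
refine (conj (conj Hu1 (conj Hs1 (conj _ _))) (fun t => conj (Hu2 t) (Hs2 t))).
- intros t. eapply continuous_of_is_derive, Hu2.
- intros t. eapply continuous_of_is_derive, Hs2.
Qed.

(** For a forcing g' at least g, a supersolution of the linear system driven by g'
lies above a subsolution of the one driven by g: the two differences satisfy the
differential inequalities of the comparison principle. With both pairs exact it
says that the response is monotone in the forcing; with one of them exact it says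
that iteration improves sub- and supersolutions. *)
Lemma sub_le_super (r T : R) (s s' ds ds' : (R -> R) * (R -> R)) (g g' : R -> R) :
  0 < r -> 0 < T ->
  periodic T (fst s) -> periodic T (snd s) ->
  periodic T (fst s') -> periodic T (snd s') ->
  (forall t, is_derive (fst s) t (fst ds t) /\ is_derive (snd s) t (snd ds t)) ->
  (forall t, is_derive (fst s') t (fst ds' t) /\ is_derive (snd s') t (snd ds' t)) ->
  (forall t, r * fst s t - g t <= fst ds t /\ snd ds t <= - r * snd s t + g t) ->
  (forall t, fst ds' t <= r * fst s' t - g' t /\ - r * snd s' t + g' t <= snd ds' t) ->
  (forall t, g t <= g' t) ->
  pair_le s s'.
Proof.
intros Hr HT Hp1 Hp2 Hp1' Hp2' Hd Hd' Hsub Hsup Hg t.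
split; apply Rminus_le_0.
- apply (periodic_nonneg_of_derive_le r T (fun t => fst s' t - fst s t)
    (fun t => fst ds' t - fst ds t)); try assumption.
  + intros x. now rewrite Hp1, Hp1'.
  + intros x. apply (is_derive_minus (V := R_NormedModule)); [apply Hd' | apply Hd].
  + intros x. generalize (Hsub x) (Hsup x) (Hg x). lra.
- apply (periodic_nonneg_of_derive_ge r T (fun t => snd s' t - snd s t)
    (fun t => snd ds' t - snd ds t)); try assumption.
  + intros x. now rewrite Hp2, Hp2'.
  + intros x. apply (is_derive_minus (V := R_NormedModule)); [apply Hd' | apply Hd].
  + intros x. generalize (Hsub x) (Hsup x) (Hg x). lra.
Qed.

(** Iterating the response operator from the subsolution a gives an increasing
sequence bounded by the supersolution b, because the operator is monotone. Its
pointwise limit is a solution: derivatives of the iterates are uniformly bounded,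
so the iterates, hence also the forcings and the derivatives of the next iterates,
are equi-Lipschitz. *)
Lemma monotone_periodic_system (r T L : R) (G : R -> R -> R -> R)
  (a b da db : (R -> R) * (R -> R)) :
  0 < r -> 0 < T -> lipschitz3 L G ->
  (forall t y z, G (t + T) y z = G t y z) ->
  (forall t y y' z z', y <= y' -> z <= z' -> G t y z <= G t y' z') ->
  periodic T (fst a) -> periodic T (snd a) ->
  periodic T (fst b) -> periodic T (snd b) ->
  (forall t, is_derive (fst a) t (fst da t) /\ is_derive (snd a) t (snd da t)) ->
  (forall t, is_derive (fst b) t (fst db t) /\ is_derive (snd b) t (snd db t)) ->
  (forall t, r * fst a t - forcing G a t <= fst da t /\
             snd da t <= - r * snd a t + forcing G a t) ->
  (forall t, fst db t <= r * fst b t - forcing G b t /\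
             - r * snd b t + forcing G b t <= snd db t) ->
  pair_le a b ->
  exists s : (R -> R) * (R -> R),
    periodic T (fst s) /\ periodic T (snd s) /\
    (forall t, is_derive (fst s) t (r * fst s t - forcing G s t) /\
               is_derive (snd s) t (- r * snd s t + forcing G s t)) /\
    pair_le a s /\ pair_le s b.
Proof.
intros Hr HT HL Hper Hmono Ha1 Ha2 Hb1 Hb2 Hda Hdb Hsub Hsup Hab.
assert (HL0 := lipschitz3_nonneg L G HL).
assert (Hpa : periodic_pair T a).
{ refine (conj Ha1 (conj Ha2 (conj _ _))); intros t;
    [apply (continuous_of_is_derive _ _ (fst da t)) | apply (continuous_of_is_derive _ _ (snd da t))];
    apply (Hda t). }
assert (Hpb : periodic_pair T b).
{ refine (conj Hb1 (conj Hb2 (conj _ _))); intros t;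
    [apply (continuous_of_is_derive _ _ (fst db t)) | apply (continuous_of_is_derive _ _ (snd db t))];
    apply (Hdb t). }
assert (Hforce : forall s s', pair_le s s' -> forall t, forcing G s t <= forcing G s' t).
{ intros s s' Hs t. apply Hmono; apply Hs. }
set (X := fun n => Nat.iter n (response r T G) a).
assert (HXp : forall n, periodic_pair T (X n)).
{ induction n as [|n IH]; [exact Hpa|]. now apply (response_spec r T L). }
assert (HXd : forall n t,
  is_derive (fst (X (S n))) t (r * fst (X (S n)) t - forcing G (X n) t) /\
  is_derive (snd (X (S n))) t (- r * snd (X (S n)) t + forcing G (X n) t)).
{ intros n. now apply (response_spec r T L). }
assert (HXb : forall n, pair_le (X n) b).
{ induction n as [|n IH]; [exact Hab|].
  destruct (HXp (S n)) as [H1 [H2 _]].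
  apply (sub_le_super r T (X (S n)) b
    (fun t => r * fst (X (S n)) t - forcing G (X n) t,
     fun t => - r * snd (X (S n)) t + forcing G (X n) t) db
    (forcing G (X n)) (forcing G b)); simpl; try assumption.
  - apply HXd.
  - intros t; lra.
  - now apply Hforce. }
assert (HXincr : forall n, pair_le (X n) (X (S n))).
{ induction n as [|n IH].
  - destruct (HXp 1%nat) as [H1 [H2 _]].
    apply (sub_le_super r T a (X 1%nat) da
      (fun t => r * fst (X 1%nat) t - forcing G a t,
       fun t => - r * snd (X 1%nat) t + forcing G a t)
      (forcing G a) (forcing G a)); try assumption.
    + apply (HXd 0%nat).
    + simpl; intros t; lra.
    + intros t; lra.
  - destruct (HXp (S n)) as [H1 [H2 _]]. destruct (HXp (S (S n))) as [H3 [H4 _]].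
    apply (sub_le_super r T (X (S n)) (X (S (S n)))
      (fun t => r * fst (X (S n)) t - forcing G (X n) t,
       fun t => - r * snd (X (S n)) t + forcing G (X n) t)
      (fun t => r * fst (X (S (S n))) t - forcing G (X (S n)) t,
       fun t => - r * snd (X (S (S n))) t + forcing G (X (S n)) t)
      (forcing G (X n)) (forcing G (X (S n)))); try assumption.
    + apply (HXd n).
    + apply (HXd (S n)).
    + simpl; intros t; lra.
    + simpl; intros t; lra.
    + now apply Hforce. }
assert (HaX : forall n, pair_le a (X n)).
{ induction n as [|n IH]; intros t.
  - split; apply Rle_refl.
  - generalize (IH t) (HXincr n t). lra. }
clearbody X.
assert (Hlim : exists s : (R -> R) * (R -> R), forall t,
  is_lim_seq (fun n => fst (X n) t) (fst s t) /\
  is_lim_seq (fun n => snd (X n) t) (snd s t)).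
{ exists (fun t => real (Lim_seq (fun n => fst (X n) t)),
          fun t => real (Lim_seq (fun n => snd (X n) t))).
  intros t; split; apply Lim_seq_correct'.
  - apply ex_finite_lim_seq_incr with (fst b t); intros n;
      [apply HXincr | apply HXb].
  - apply ex_finite_lim_seq_incr with (snd b t); intros n;
      [apply HXincr | apply HXb]. }
destruct Hlim as [s Hs].
exists s.
assert (Hbound : exists B, 0 <= B /\ forall n t,
  Rabs (fst (X n) t) <= B /\ Rabs (snd (X n) t) <= B /\ Rabs (forcing G (X n) t) <= B).
{ destruct Hpa as [_ [_ [Hac1 Hac2]]]. destruct Hpb as [_ [_ [Hbc1 Hbc2]]].
  destruct (bounded_periodic T _ HT Hac1 Ha1) as [B1 [HB1 HB1']].
  destruct (bounded_periodic T _ HT Hac2 Ha2) as [B2 [HB2 HB2']].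
  destruct (bounded_periodic T _ HT Hbc1 Hb1) as [B3 [HB3 HB3']].
  destruct (bounded_periodic T _ HT Hbc2 Hb2) as [B4 [HB4 HB4']].
  destruct (bounded_periodic T (fun t => G t 0 0) HT) as [B5 [HB5 HB5']].
  { intros t. apply (continuous_lipschitz3_comp L G (fun _ => 0) (fun _ => 0));
      [exact HL | apply continuous_const | apply continuous_const]. }
  { intros t. apply Hper. }
  set (B := B1 + B2 + B3 + B4).
  assert (Hy : forall n t, Rabs (fst (X n) t) <= B /\ Rabs (snd (X n) t) <= B).
  { intros n t. unfold B.
    generalize (HaX n t) (HXb n t) (proj1 (Rabs_le_between _ _) (HB1' t))
      (proj1 (Rabs_le_between _ _) (HB2' t)) (proj1 (Rabs_le_between _ _) (HB3' t))
      (proj1 (Rabs_le_between _ _) (HB4' t)).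
    intros; split; apply Rabs_le; lra. }
  exists (B + B5 + L * (B + B)). assert (HB : 0 <= B) by (unfold B; lra).
  assert (0 <= L * (B + B)) by (apply Rmult_le_pos; lra).
  split; [lra|]. intros n t. destruct (Hy n t) as [Hy1 Hy2].
  split; [lra|]. split; [lra|].
  assert (Hd := HL t t 0 (fst (X n) t) 0 (snd (X n) t)).
  rewrite Rminus_diag, Rabs_R0, !Rminus_0_r, Rplus_0_l in Hd.
  fold (forcing G (X n) t) in Hd.
  assert (L * (Rabs (fst (X n) t) + Rabs (snd (X n) t)) <= L * (B + B))
    by (apply Rmult_le_compat_l; lra).
  assert (Htri := Rabs_triang (forcing G (X n) t - G t 0 0) (G t 0 0)).
  replace (forcing G (X n) t - G t 0 0 + G t 0 0) with (forcing G (X n) t) in Htri by ring.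
  generalize (HB5' t). lra. }
destruct Hbound as [B [HB0 HB]].
set (C := r * B + B).
assert (HC0 : 0 <= C) by (unfold C; nra).
(* The iterates are Lipschitz with a common constant only from index 1 on, where
   they are responses; their derivatives are so only from index 2 on. *)
assert (HXlip : forall n t t',
  Rabs (fst (X (S n)) t' - fst (X (S n)) t) <= C * Rabs (t' - t) /\
  Rabs (snd (X (S n)) t' - snd (X (S n)) t) <= C * Rabs (t' - t)).
{ intros n t t'. split.
  - apply (lipschitz_of_derive_bound (fst (X (S n)))
      (fun t => r * fst (X (S n)) t - forcing G (X n) t)); intros x _; [apply HXd|].
    destruct (HB (S n) x) as [H1 _]. destruct (HB n x) as [_ [_ H2]].
    apply Rabs_le_between in H1. apply Rabs_le_between in H2.
    apply Rabs_le. unfold C. split; nra.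
  - apply (lipschitz_of_derive_bound (snd (X (S n)))
      (fun t => - r * snd (X (S n)) t + forcing G (X n) t)); intros x _; [apply HXd|].
    destruct (HB (S n) x) as [_ [H1 _]]. destruct (HB n x) as [_ [_ H2]].
    apply Rabs_le_between in H1. apply Rabs_le_between in H2.
    apply Rabs_le. unfold C. split; nra. }
assert (HFlip : forall n t t',
  Rabs (forcing G (X (S n)) t' - forcing G (X (S n)) t)
  <= L * (1 + C + C) * Rabs (t' - t)).
{ intros n t t'. eapply Rle_trans; [apply HL|].
  rewrite Rmult_assoc. apply Rmult_le_compat_l; [exact HL0|].
  destruct (HXlip n t t'). lra. }
assert (Hlim1 : forall t, is_lim_seq (fun n => fst (X (S n)) t) (fst s t))
  by (intros t; apply (is_lim_seq_incr_1 (fun n => fst (X n) t)), Hs).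
assert (Hlim1' : forall t, is_lim_seq (fun n => snd (X (S n)) t) (snd s t))
  by (intros t; apply (is_lim_seq_incr_1 (fun n => snd (X n) t)), Hs).
assert (Hlim2 : forall t, is_lim_seq (fun n => fst (X (S (S n))) t) (fst s t))
  by (intros t; apply (is_lim_seq_incr_1 (fun n => fst (X (S n)) t)), Hlim1).
assert (Hlim2' : forall t, is_lim_seq (fun n => snd (X (S (S n))) t) (snd s t))
  by (intros t; apply (is_lim_seq_incr_1 (fun n => snd (X (S n)) t)), Hlim1').
assert (HlimF : forall t, is_lim_seq (fun n => forcing G (X (S n)) t) (forcing G s t)).
{ intros t. apply (is_lim_seq_lipschitz3_comp L G t
    (fun n => fst (X (S n)) t) (fun n => snd (X (S n)) t)); auto. }
assert (Hclose : forall x y c d : R, Rabs x <= c -> Rabs y <= d -> Rabs (x + y) <= c + d).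
{ intros x y c d Hx Hy. eapply Rle_trans; [apply Rabs_triang | lra]. }
assert (Hrabs : forall x, Rabs (r * x) = r * Rabs x)
  by (intros x; rewrite Rabs_mult, (Rabs_right r) by lra; reflexivity).
refine (conj _ (conj _ (conj (fun t => conj _ _) (conj (fun t => conj _ _) (fun t => conj _ _))))).
- intros t.
  assert (H1 := proj1 (Hs (t + T))).
  apply (is_lim_seq_ext _ (fun n => fst (X n) t)) in H1.
  + apply is_lim_seq_unique in H1. assert (H2 := is_lim_seq_unique _ _ (proj1 (Hs t))).
    congruence.
  + intros n. apply (HXp n).
- intros t.
  assert (H1 := proj2 (Hs (t + T))).
  apply (is_lim_seq_ext _ (fun n => snd (X n) t)) in H1.
  + apply is_lim_seq_unique in H1. assert (H2 := is_lim_seq_unique _ _ (proj2 (Hs t))).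
    congruence.
  + intros n. apply (HXp n).
- apply (is_derive_pointwise_limit (fun n => fst (X (S (S n))))
    (fun n t => r * fst (X (S (S n))) t - forcing G (X (S n)) t) (fst s)
    (fun t => r * fst s t - forcing G s t) (r * C + L * (1 + C + C))); auto.
  + intros n x. apply HXd.
  + intros n x x'.
    replace (r * fst (X (S (S n))) x' - forcing G (X (S n)) x' -
      (r * fst (X (S (S n))) x - forcing G (X (S n)) x))
      with (r * (fst (X (S (S n))) x' - fst (X (S (S n))) x)
            + - (forcing G (X (S n)) x' - forcing G (X (S n)) x)) by ring.
    rewrite Rmult_plus_distr_r. apply Hclose.
    * rewrite Hrabs, Rmult_assoc. apply Rmult_le_compat_l; [lra | apply HXlip].
    * rewrite Rabs_Ropp. apply HFlip.
  + intros x. apply is_lim_seq_minus'; [|apply HlimF].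
    apply (is_lim_seq_scal_l _ r (fst s x)), Hlim2.
- apply (is_derive_pointwise_limit (fun n => snd (X (S (S n))))
    (fun n t => - r * snd (X (S (S n))) t + forcing G (X (S n)) t) (snd s)
    (fun t => - r * snd s t + forcing G s t) (r * C + L * (1 + C + C))); auto.
  + intros n x. apply HXd.
  + intros n x x'.
    replace (- r * snd (X (S (S n))) x' + forcing G (X (S n)) x' -
      (- r * snd (X (S (S n))) x + forcing G (X (S n)) x))
      with (- (r * (snd (X (S (S n))) x' - snd (X (S (S n))) x))
            + (forcing G (X (S n)) x' - forcing G (X (S n)) x)) by ring.
    rewrite Rmult_plus_distr_r. apply Hclose.
    * rewrite Rabs_Ropp, Hrabs, Rmult_assoc.
      apply Rmult_le_compat_l; [lra | apply HXlip].
    * apply HFlip.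
  + intros x. apply is_lim_seq_plus'; [|apply HlimF].
    apply (is_lim_seq_scal_l _ (- r) (snd s x)), Hlim2'.
- apply (is_lim_seq_bounds (fun n => fst (X n) t) (fst s t) (fst a t) (fst b t));
    [intros n; split; [apply HaX | apply HXb] | apply Hs].
- apply (is_lim_seq_bounds (fun n => snd (X n) t) (snd s t) (snd a t) (snd b t));
    [intros n; split; [apply HaX | apply HXb] | apply Hs].
- apply (is_lim_seq_bounds (fun n => fst (X n) t) (fst s t) (fst a t) (fst b t));
    [intros n; split; [apply HaX | apply HXb] | apply Hs].
- apply (is_lim_seq_bounds (fun n => snd (X n) t) (snd s t) (snd a t) (snd b t));
    [intros n; split; [apply HaX | apply HXb] | apply Hs].
Qed.

(** * Periodic solutions between a lower and an upper solution *)

(** With y = r q + q' and z = r q - q', the equation q'' = F t q q' becomes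
y' = r y - G t y z, z' = - r z + G t y z, where G t y z = r^2 q - F t q q'. *)
Definition cooperative_forcing (r : R) (F : R -> R -> R -> R) (t y z : R) : R :=
  r ^ 2 * ((y + z) / (2 * r)) - F t ((y + z) / (2 * r)) ((y - z) / 2).

Lemma cooperative_forcing_lipschitz (r L : R) (F : R -> R -> R -> R) :
  1 <= r -> lipschitz3 L F ->
  lipschitz3 (r + L) (cooperative_forcing r F).
Proof.
intros Hr HF t t' y y' z z'. unfold cooperative_forcing. assert (HL := lipschitz3_nonneg L F HF).
assert (H := HF t t' ((y + z) / (2 * r)) ((y' + z') / (2 * r)) ((y - z) / 2) ((y' - z') / 2)).
set (A := F t' _ _) in *. set (A0 := F t _ _) in *.
assert (Hq : Rabs ((y' + z') / (2 * r) - (y + z) / (2 * r))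
             <= / 2 * (Rabs (y' - y) + Rabs (z' - z))).
{ replace ((y' + z') / (2 * r) - (y + z) / (2 * r))
    with (/ r * (/ 2 * ((y' - y) + (z' - z)))) by (field; lra).
  assert (Hr1 : 0 < / r <= 1).
  { split; [apply Rinv_0_lt_compat; lra|]. rewrite <- Rinv_1.
    apply Rinv_le_contravar; lra. }
  rewrite !Rabs_mult, (Rabs_right (/ r)), (Rabs_right (/ 2)) by lra.
  assert (Htri := Rabs_triang (y' - y) (z' - z)).
  generalize (Rabs_pos (y' - y + (z' - z))). nra. }
assert (Hv : Rabs ((y' - z') / 2 - (y - z) / 2)
             <= / 2 * (Rabs (y' - y) + Rabs (z' - z))).
{ replace ((y' - z') / 2 - (y - z) / 2) with (/ 2 * ((y' - y) + - (z' - z))) by field.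
  rewrite Rabs_mult, (Rabs_right (/ 2)) by lra.
  assert (Htri := Rabs_triang (y' - y) (- (z' - z))).
  rewrite Rabs_Ropp in Htri. lra. }
replace (r ^ 2 * ((y' + z') / (2 * r)) - A - (r ^ 2 * ((y + z) / (2 * r)) - A0))
  with (r / 2 * ((y' - y) + (z' - z)) + - (A - A0)) by (field; lra).
eapply Rle_trans; [apply Rabs_triang|].
rewrite Rabs_Ropp, Rabs_mult, (Rabs_right (r / 2)) by lra.
assert (Htri := Rabs_triang (y' - y) (z' - z)).
assert (Ha := Rabs_pos (t' - t)). assert (Hb := Rabs_pos (y' - y)).
assert (Hc := Rabs_pos (z' - z)).
assert (r / 2 * Rabs (y' - y + (z' - z)) <= r / 2 * (Rabs (y' - y) + Rabs (z' - z)))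
  by (apply Rmult_le_compat_l; lra).
assert (Hs : L * (Rabs (t' - t) + Rabs ((y' + z') / (2 * r) - (y + z) / (2 * r))
                  + Rabs ((y' - z') / 2 - (y - z) / 2))
             <= L * (Rabs (t' - t) + Rabs (y' - y) + Rabs (z' - z)))
  by (apply Rmult_le_compat_l; lra).
assert (0 <= r * (Rabs (t' - t) + (Rabs (y' - y) + Rabs (z' - z)) / 2))
  by (apply Rmult_le_pos; lra).
nra.
Qed.

(** If y and z increase, q increases by some w >= 0 and q' changes by at most r w.
Thus F changes by at most L (1 + r) w, which r^2 w dominates once r >= 1 + L. *)
Lemma cooperative_forcing_monotone (r L : R) (F : R -> R -> R -> R) (t y y' z z' : R) :
  1 + L <= r -> lipschitz3 L F -> y <= y' -> z <= z' ->
  cooperative_forcing r F t y z <= cooperative_forcing r F t y' z'.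
Proof.
intros Hr HF Hy Hz. unfold cooperative_forcing. assert (HL := lipschitz3_nonneg L F HF).
assert (H := HF t t ((y + z) / (2 * r)) ((y' + z') / (2 * r)) ((y - z) / 2) ((y' - z') / 2)).
set (A := F t ((y' + z') / (2 * r)) _) in *. set (A0 := F t ((y + z) / (2 * r)) _) in *.
set (w := (y' - y + (z' - z)) / (2 * r)).
assert (Hw : 0 <= w) by (apply Rle_mult_inv_pos; lra).
assert (Hq : Rabs ((y' + z') / (2 * r) - (y + z) / (2 * r)) = w).
{ rewrite Rabs_right; unfold w; [field; lra|].
  apply Rle_ge. replace ((y' + z') / (2 * r) - (y + z) / (2 * r)) with w; [easy|].
  unfold w; field; lra. }
assert (Hv : Rabs ((y' - z') / 2 - (y - z) / 2) <= r * w).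
{ replace (r * w) with ((y' - y + (z' - z)) / 2) by (unfold w; field; lra).
  apply Rabs_le; lra. }
rewrite Hq, Rminus_diag, Rabs_R0, Rplus_0_l in H.
replace (r ^ 2 * ((y' + z') / (2 * r))) with (r ^ 2 * ((y + z) / (2 * r)) + r * r * w)
  by (unfold w; field; lra).
apply Rabs_le_between in H.
assert (L * (w + Rabs ((y' - z') / 2 - (y - z) / 2)) <= L * (w + r * w))
  by (apply Rmult_le_compat_l; lra).
assert (L * (w + r * w) <= r * r * w).
{ assert ((1 + L) * (r * w) <= r * (r * w)) by (apply Rmult_le_compat_r; [nra | lra]).
  assert (L * w <= r * w) by (apply Rmult_le_compat_r; lra). lra. }
lra.
Qed.

(** In the variables r q + q' and r q - q' a lower solution is a subsolution of a
cooperative system. These variables order al and be as soon as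
r (be - al) >= |be' - al'|; this is where the positive gap enters. *)
Lemma periodic_between_lower_and_upper (T L gap : R) (F : R -> R -> R -> R)
  (al dal ddal be dbe ddbe : R -> R) :
  0 < T -> lipschitz3 L F -> (forall t q v, F (t + T) q v = F t q v) ->
  periodic T al -> periodic T dal -> periodic T be -> periodic T dbe ->
  (forall t, is_derive al t (dal t)) -> (forall t, is_derive dal t (ddal t)) ->
  (forall t, is_derive be t (dbe t)) -> (forall t, is_derive dbe t (ddbe t)) ->
  (forall t, F t (al t) (dal t) <= ddal t) ->
  (forall t, ddbe t <= F t (be t) (dbe t)) ->
  0 < gap -> (forall t, al t + gap <= be t) ->
  exists q v : R -> R,
    periodic T q /\ periodic T v /\
    (forall t, is_derive q t (v t)) /\
    (forall t, is_derive v t (F t (q t) (v t))) /\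
    (forall t, al t <= q t <= be t).
Proof.
intros HT HF Hper Hpa Hpda Hpb Hpdb Ha Hda Hb Hdb Hlow Hup Hgap Hab.
assert (HL := lipschitz3_nonneg L F HF).
destruct (bounded_periodic T dal HT) as [A [HA HA']];
  [intros t; eapply continuous_of_is_derive, Hda | exact Hpda |].
destruct (bounded_periodic T dbe HT) as [B [HB HB']];
  [intros t; eapply continuous_of_is_derive, Hdb | exact Hpdb |].
set (r := 1 + L + (A + B) / gap).
assert (Hr0 : 0 <= (A + B) / gap) by (apply Rle_mult_inv_pos; lra).
assert (Hr : 1 + L <= r) by (unfold r; lra).
assert (Hrgap : A + B <= r * gap).
{ unfold r. replace (A + B) with ((A + B) / gap * gap) at 1 by (field; lra).
  apply Rmult_le_compat_r; lra. }
set (G := cooperative_forcing r F).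
assert (HG : forall (u du : R -> R) t,
  forcing G (fun t => r * u t + du t, fun t => r * u t - du t) t
  = r ^ 2 * u t - F t (u t) (du t)).
{ intros u du t. unfold forcing, G, cooperative_forcing; simpl.
  replace ((r * u t + du t + (r * u t - du t)) / (2 * r)) with (u t) by (field; lra).
  replace ((r * u t + du t - (r * u t - du t)) / 2) with (du t) by field.
  reflexivity. }
assert (Hpd : forall (u du ddu : R -> R), (forall t, is_derive u t (du t)) ->
  (forall t, is_derive du t (ddu t)) -> forall t,
  is_derive (fun t => r * u t + du t) t (r * du t + ddu t) /\
  is_derive (fun t => r * u t - du t) t (r * du t - ddu t)).
{ intros u du ddu Hu Hdu t. split.
  - apply (is_derive_plus (V := R_NormedModule)); [apply is_derive_scal, Hu | apply Hdu].
  - apply (is_derive_minus (V := R_NormedModule)); [apply is_derive_scal, Hu | apply Hdu]. }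
destruct (monotone_periodic_system r T (r + L) G
  (fun t => r * al t + dal t, fun t => r * al t - dal t)
  (fun t => r * be t + dbe t, fun t => r * be t - dbe t)
  (fun t => r * dal t + ddal t, fun t => r * dal t - ddal t)
  (fun t => r * dbe t + ddbe t, fun t => r * dbe t - ddbe t))
  as [s [Hp1 [Hp2 [Hs [Hlo Hhi]]]]]; try assumption.
- lra.
- apply cooperative_forcing_lipschitz; [lra | exact HF].
- intros t y z. unfold G, cooperative_forcing. now rewrite Hper.
- intros t y y' z z'. now apply (cooperative_forcing_monotone r L).
- intros t. simpl. now rewrite Hpa, Hpda.
- intros t. simpl. now rewrite Hpa, Hpda.
- intros t. simpl. now rewrite Hpb, Hpdb.
- intros t. simpl. now rewrite Hpb, Hpdb.
- now apply (Hpd al dal ddal).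
- now apply (Hpd be dbe ddbe).
- intros t. rewrite HG. simpl. generalize (Hlow t). lra.
- intros t. rewrite HG. simpl. generalize (Hup t). lra.
- intros t. simpl.
  assert (H1 := HA' t). assert (H2 := HB' t).
  apply Rabs_le_between in H1. apply Rabs_le_between in H2.
  assert (r * (al t + gap) <= r * be t) by (apply Rmult_le_compat_l; [lra | apply Hab]).
  lra.
- exists (fun t => (fst s t + snd s t) / (2 * r)), (fun t => (fst s t - snd s t) / 2).
  refine (conj _ (conj _ (conj _ (conj _ _)))).
  + intros t. now rewrite Hp1, Hp2.
  + intros t. now rewrite Hp1, Hp2.
  + intros t. destruct (Hs t) as [H1 H2].
    apply (is_derive_ext (fun t => / (2 * r) * (fst s t + snd s t)));
      [intros x; simpl; field; lra|].
    replace ((fst s t - snd s t) / 2) with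
      (/ (2 * r) * ((r * fst s t - forcing G s t) + (- r * snd s t + forcing G s t)))
      by (field; lra).
    apply is_derive_scal, (is_derive_plus (V := R_NormedModule)); assumption.
  + intros t. destruct (Hs t) as [H1 H2].
    apply (is_derive_ext (fun t => / 2 * (fst s t - snd s t))); [intros x; simpl; field|].
    replace (F t _ _) with
      (/ 2 * ((r * fst s t - forcing G s t) - (- r * snd s t + forcing G s t)))
      by (unfold forcing, G, cooperative_forcing; field; lra).
    apply is_derive_scal, (is_derive_minus (V := R_NormedModule)); assumption.
  + intros t. generalize (Hlo t) (Hhi t). simpl. intros [H1 H2] [H3 H4].
    split; [apply Rle_div_r | apply Rle_div_l]; lra.
Qed.

(** * A lower solution adapted to the fast oscillation *)

(** The zero mean of f makes its primitives periodic, and subtracting the mean of a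
primitive allows the construction to be repeated. *)
Lemma zero_mean_antiderivative (T : R) (f : R -> R) :
  0 < T -> (forall t, continuous f t) -> periodic T f -> is_RInt f 0 T 0 ->
  exists F : R -> R,
    (forall t, is_derive F t (f t)) /\ periodic T F /\ is_RInt F 0 T 0.
Proof.
intros HT Hf Hper Hint.
set (E := fun t => RInt f 0 t).
assert (HE : forall t, is_derive E t (f t))
  by (intros t; now apply continuous_RInt_derive).
assert (HEint : is_RInt E 0 T (RInt E 0 T)).
{ apply (RInt_correct (V := R_CompleteNormedModule)).
  apply (ex_RInt_continuous (V := R_CompleteNormedModule)).
  intros t _. eapply continuous_of_is_derive, HE. }
set (m := RInt E 0 T / T).
exists (fun t => E t - m). refine (conj _ (conj _ _)).
- intros t. replace (f t) with (f t - 0) by ring.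
  apply (is_derive_minus (V := R_NormedModule)); [apply HE | apply is_derive_Reals, derivable_pt_lim_const].
- intros t. f_equal.
  assert (Hc : E (t + T) - E t = E (0 + T) - E 0).
  { apply (constant_of_derive_zero (fun t => E (t + T) - E t)). intros s.
    replace 0 with (f (s + T) - f s) by (rewrite Hper; ring).
    apply (is_derive_minus (V := R_NormedModule)); [apply is_derive_shift, HE | apply HE]. }
  assert (HE0 : E 0 = 0) by (apply (RInt_point (V := R_CompleteNormedModule))).
  assert (HET : E T = 0) by now apply (is_RInt_unique (V := R_CompleteNormedModule)).
  rewrite Rplus_0_l in Hc. lra.
- replace 0 with (RInt E 0 T - (T - 0) * m) at 2 by (unfold m; field; lra).
  apply (is_RInt_minus (V := R_NormedModule)); [exact HEint|].
  apply (is_RInt_const (V := R_NormedModule)).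
Qed.

Lemma periodic_rescale (T : R) (f : R -> R) (k : nat) :
  periodic T f -> periodic T (fun t => f (INR k * t)).
Proof.
intros Hf t. rewrite Rmult_plus_distr_l. now apply periodic_INR.
Qed.

Lemma is_derive_rescale (f : R -> R) (a t l : R) :
  is_derive f (a * t) l -> is_derive (fun s => f (a * s)) t (a * l).
Proof.
intros H. auto_derive; [now exists l|].
replace (Derive (fun x : R => f x) (a * t)) with l
  by (symmetry; apply is_derive_unique, H). ring.
Qed.

(** Eliminating p = q' + phi (k t) sin q from the system leaves the equation
q'' = pendulum_force t q q', in which the terms with phi^2 and with phi q' cos q
have cancelled. *)
Definition pendulum_force (mu : R) (phi dphi : R -> R) (h : R -> R -> R -> R)
  (k : nat) (t q v : R) : R :=
  - mu * v - sin q - INR k * dphi (INR k * t) * sin q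
  + h q (v + phi (INR k * t) * sin q) t.

Lemma Rabs_mult_le (x y a b : R) :
  Rabs x <= a -> Rabs y <= b -> Rabs (x * y) <= a * b.
Proof.
intros Hx Hy. rewrite Rabs_mult.
apply Rmult_le_compat; try apply Rabs_pos; assumption.
Qed.

Lemma Rabs_plus_le (x y a b : R) :
  Rabs x <= a -> Rabs y <= b -> Rabs (x + y) <= a + b.
Proof.
intros Hx Hy. eapply Rle_trans; [apply Rabs_triang | lra].
Qed.

(** The sine is flat at a right angle: on the d-neighbourhood of PI / 2 its
Lipschitz constant is at most d. This gains the factor 1 / k that compensates the
factor k in front of phi'. *)
Lemma sin_increment_near_right_angle (x y d e : R) :
  Rabs (x - PI / 2) <= d -> Rabs (y - PI / 2) <= d -> Rabs (x - y) <= e ->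
  Rabs (sin x - sin y) <= d * e.
Proof.
intros Hx Hy Hxy. rewrite form4.
replace (2 * cos ((x + y) / 2) * sin ((x - y) / 2))
  with (cos ((x + y) / 2) * (2 * sin ((x - y) / 2))) by ring.
apply Rabs_mult_le.
- rewrite <- sin_shift.
  assert (H := sin_lipschitz 0 (PI / 2 - (x + y) / 2)).
  rewrite sin_0, !Rminus_0_r in H. eapply Rle_trans; [exact H|].
  apply Rabs_le_between in Hx. apply Rabs_le_between in Hy. apply Rabs_le. lra.
- assert (H := sin_lipschitz 0 ((x - y) / 2)).
  rewrite sin_0, !Rminus_0_r in H.
  rewrite Rabs_mult, (Rabs_right 2) by lra.
  unfold Rdiv in *. rewrite Rabs_mult, (Rabs_right (/ 2)) in H by lra. lra.
Qed.

(** The constant PI / 2 is a lower solution of the averaged equation, since h < 1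
there. To survive the force - k phi'(k t) sin q, it is made to follow the fast
motion: with c = PI / 2 + A / k and primitives Phi, Phi2 of phi,
al = c - sin c (Phi(k t) / k - mu Phi2(k t) / k^2)
satisfies al'' + mu al' = - k phi'(k t) sin c + O(1/k). The Phi2 term cancels the
friction acting on the fast motion, which would otherwise be of order 1. Since
sin al - sin c = O(1/k^2) near a right angle, the defect of al is eps - O(1/k).
The shift A / k exceeds the amplitude of the oscillation, so al stays above PI / 2. *)
Lemma oscillating_lower_solution (T mu B eps L : R) (phi dphi Phi Phi2 : R -> R)
  (h : R -> R -> R -> R) :
  0 <= mu -> 0 < eps -> 0 <= L ->
  (forall t, is_derive phi t (dphi t)) ->
  (forall t, is_derive Phi t (phi t)) ->
  (forall t, is_derive Phi2 t (Phi t)) ->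
  periodic T phi -> periodic T Phi -> periodic T Phi2 ->
  (forall t, Rabs (phi t) <= B) -> (forall t, Rabs (dphi t) <= B) ->
  (forall t, Rabs (Phi t) <= B) -> (forall t, Rabs (Phi2 t) <= B) ->
  (forall q p t, Rabs (q - PI / 2) <= 1 -> Rabs p <= 1 ->
     h q p t <= 1 - eps + L * (Rabs (q - PI / 2) + Rabs p)) ->
  exists K : nat, forall k : nat, (K < k)%nat ->
    exists al dal ddal : R -> R,
      periodic T al /\ periodic T dal /\
      (forall t, is_derive al t (dal t)) /\
      (forall t, is_derive dal t (ddal t)) /\
      (forall t, PI / 2 < al t <= PI / 2 + 1) /\
      (forall t, Rabs (dal t + phi (INR k * t) * sin (al t)) <= 1) /\
      (forall t, pendulum_force mu phi dphi h k t (al t) (dal t) <= ddal t).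
Proof.
intros Hmu Heps HL Hphi HPhi HPhi2 Pphi PPhi PPhi2 Bphi Bdphi BPhi BPhi2 Hh.
assert (HB : 0 <= B) by (eapply Rle_trans; [apply Rabs_pos | apply (Bphi 0)]).
(* In units of 1 / k: C1 bounds |al - c|, A2 bounds |al - PI / 2|, A3 bounds the
   momentum al' + phi sin al, and D bounds the total loss in the inequality. *)
set (C1 := B * (1 + mu)). set (A := C1 + 1). set (A2 := C1 + A).
set (A3 := B * (A2 * C1) + mu * B).
set (D := B * (A2 * C1) + mu ^ 2 * B + A2 + L * (A2 + A3)).
assert (HC1 : 0 <= C1) by (apply Rmult_le_pos; lra).
assert (HA2 : 0 <= A2) by (unfold A2, A; lra).
assert (HA2C1 : 0 <= A2 * C1) by (apply Rmult_le_pos; lra).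
assert (HmuB : 0 <= mu * B) by (apply Rmult_le_pos; lra).
assert (HA3 : 0 <= A3) by (unfold A3; nra).
assert (HD : 0 <= D).
{ unfold D. assert (0 <= mu ^ 2 * B) by (apply Rmult_le_pos; [apply pow2_ge_0 | lra]).
  assert (0 <= L * (A2 + A3)) by (apply Rmult_le_pos; lra).
  assert (0 <= B * (A2 * C1)) by (apply Rmult_le_pos; lra). lra. }
destruct (INR_unbounded (1 + A2 + A3 + D / eps)) as [K HK].
exists K. intros k Hk.
assert (HDe : 0 <= D / eps) by (apply Rle_mult_inv_pos; lra).
assert (Hkappa : 1 + A2 + A3 + D / eps < INR k)
  by (apply Rlt_trans with (1 := HK); now apply lt_INR).
set (kappa := INR k) in *. set (e := / kappa).
assert (Hk0 : 0 < kappa) by lra.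
assert (He : 0 < e) by now apply Rinv_0_lt_compat.
assert (Hke : kappa * e = 1) by (apply Rinv_r; lra).
assert (He1 : e <= 1) by nra.
assert (HeA2 : A2 * e <= 1) by nra.
assert (HeA3 : A3 * e <= 1) by nra.
assert (HeD : D * e <= eps).
{ assert (HDk : D / eps * eps <= kappa * eps) by (apply Rmult_le_compat_r; lra).
  replace (D / eps * eps) with D in HDk by (field; lra).
  replace eps with (kappa * eps * e) by (transitivity (kappa * e * eps); [ring | rewrite Hke; ring]).
  apply Rmult_le_compat_r; lra. }
set (c := PI / 2 + A * e). set (s := sin c).
assert (Hs : Rabs s <= 1) by (apply Rabs_le; generalize (SIN_bound c); unfold s; lra).
set (al := fun t => c - s * (e * Phi (kappa * t) - mu * e ^ 2 * Phi2 (kappa * t))).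
set (dal := fun t => - s * (phi (kappa * t) - mu * e * Phi (kappa * t))).
set (ddal := fun t => - s * (kappa * dphi (kappa * t) - mu * phi (kappa * t))).
assert (Hal : forall t, Rabs (al t - c) <= C1 * e).
{ intros t. unfold al.
  replace (c - s * (e * Phi (kappa * t) - mu * e ^ 2 * Phi2 (kappa * t)) - c)
    with (s * (- (e * Phi (kappa * t)) + mu * e ^ 2 * Phi2 (kappa * t))) by ring.
  rewrite <- (Rmult_1_l (C1 * e)). apply Rabs_mult_le; [exact Hs|].
  apply Rle_trans with (e * B + mu * e ^ 2 * B).
  - apply Rabs_plus_le; [rewrite Rabs_Ropp|]; apply Rabs_mult_le; try easy.
    + rewrite Rabs_right; lra.
    + assert (0 <= mu * e ^ 2) by (apply Rmult_le_pos; [lra | apply pow2_ge_0]).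
      rewrite Rabs_right; lra.
  - replace (e * B + mu * e ^ 2 * B) with (e * B + mu * B * e * e) by ring.
    replace (C1 * e) with (e * B + mu * B * e * 1) by (unfold C1; ring).
    apply Rplus_le_compat_l, Rmult_le_compat_l; [apply Rmult_le_pos|]; lra. }
assert (Hc : 0 <= c - PI / 2 <= A2 * e).
{ unfold c, A2. split.
  - assert (0 <= A * e) by (apply Rmult_le_pos; unfold A; lra). lra.
  - assert (0 <= C1 * e) by (apply Rmult_le_pos; lra). lra. }
assert (Hal2 : forall t, e <= al t - PI / 2 <= A2 * e).
{ intros t. assert (H := Hal t). apply Rabs_le_between in H.
  revert H. unfold c, A2, A. lra. }
assert (Hsin : forall t, Rabs (sin (al t) - s) <= A2 * e * (C1 * e)).
{ intros t. apply sin_increment_near_right_angle; [| |apply Hal].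
  - apply Rabs_le. generalize (Hal2 t). lra.
  - apply Rabs_le. lra. }
assert (Hp : forall t, Rabs (dal t + phi (kappa * t) * sin (al t)) <= A3 * e).
{ intros t. unfold dal.
  replace (- s * (phi (kappa * t) - mu * e * Phi (kappa * t)) + phi (kappa * t) * sin (al t))
    with (phi (kappa * t) * (sin (al t) - s) + s * (mu * e * Phi (kappa * t))) by ring.
  apply Rle_trans with (B * (A2 * e * (C1 * e)) + 1 * (mu * e * B)).
  - apply Rabs_plus_le; apply Rabs_mult_le; auto.
    apply Rabs_mult_le; [|apply BPhi].
    rewrite Rabs_right; [lra | apply Rle_ge, Rmult_le_pos; lra].
  - assert (0 <= B * (A2 * C1)) by (apply Rmult_le_pos; lra).
    replace (B * (A2 * e * (C1 * e))) with (B * (A2 * C1) * e * e) by ring.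
    replace (A3 * e) with (B * (A2 * C1) * e * 1 + 1 * (mu * e * B)) by (unfold A3; ring).
    apply Rplus_le_compat_r, Rmult_le_compat_l; [apply Rmult_le_pos|]; lra. }
assert (Hresc : forall f, periodic T f -> forall t, f (kappa * (t + T)) = f (kappa * t))
  by (intros f Hf; exact (periodic_rescale T f k Hf)).
exists al, dal, ddal.
refine (conj _ (conj _ (conj _ (conj _ (conj _ (conj _ _)))))).
- intros t. unfold al. rewrite !Hresc by assumption. reflexivity.
- intros t. unfold dal. rewrite !Hresc by assumption. reflexivity.
- intros t. unfold al, dal.
  auto_derive.
  + split; [now exists (phi (kappa * t))|]. split; [now exists (Phi (kappa * t))|easy].
  + replace (Derive (fun x : R => Phi x) (kappa * t)) with (phi (kappa * t))
      by (symmetry; apply is_derive_unique, HPhi).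
    replace (Derive (fun x : R => Phi2 x) (kappa * t)) with (Phi (kappa * t))
      by (symmetry; apply is_derive_unique, HPhi2).
    unfold e. field. lra.
- intros t. unfold dal, ddal.
  auto_derive.
  + split; [now exists (dphi (kappa * t))|]. split; [now exists (phi (kappa * t))|easy].
  + replace (Derive (fun x : R => Phi x) (kappa * t)) with (phi (kappa * t))
      by (symmetry; apply is_derive_unique, HPhi).
    replace (Derive (fun x : R => phi x) (kappa * t)) with (dphi (kappa * t))
      by (symmetry; apply is_derive_unique, Hphi).
    unfold e. field. lra.
- intros t. generalize (Hal2 t). lra.
- intros t. apply Rle_trans with (1 := Hp t). exact HeA3.
- intros t. unfold pendulum_force. fold kappa.
  assert (Hal1 : Rabs (al t - PI / 2) <= A2 * e)
    by (apply Rabs_le; generalize (Hal2 t); lra).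
  assert (Hht := Hh (al t) (dal t + phi (kappa * t) * sin (al t)) t
    (Rle_trans _ _ _ Hal1 HeA2) (Rle_trans _ _ _ (Hp t) HeA3)).
  assert (HLt : L * (Rabs (al t - PI / 2) + Rabs (dal t + phi (kappa * t) * sin (al t)))
    <= L * (A2 + A3) * e).
  { rewrite Rmult_assoc. apply Rmult_le_compat_l; [exact HL|].
    generalize (Hp t). lra. }
  assert (Hone : Rabs (sin (al t) - 1) <= A2 * e).
  { rewrite <- sin_PI2. eapply Rle_trans; [apply sin_lipschitz | exact Hal1]. }
  assert (Hmain : Rabs (kappa * dphi (kappa * t) * (sin (al t) - s)) <= B * (A2 * C1) * e).
  { replace (B * (A2 * C1) * e) with (kappa * B * (A2 * e * (C1 * e)))
      by (transitivity (kappa * e * (B * (A2 * C1) * e)); [ring | rewrite Hke; ring]).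
    apply Rabs_mult_le; [|apply Hsin]. apply Rabs_mult_le; [|apply Bdphi].
    rewrite Rabs_right; lra. }
  assert (Hsec : Rabs (s * (mu ^ 2 * e * Phi (kappa * t))) <= 1 * (mu ^ 2 * e * B)).
  { apply Rabs_mult_le; [exact Hs|]. apply Rabs_mult_le; [|apply BPhi].
    rewrite Rabs_right; [lra|].
    apply Rle_ge, Rmult_le_pos; [apply pow2_ge_0 | lra]. }
  apply Rabs_le_between in Hone. apply Rabs_le_between in Hmain.
  apply Rabs_le_between in Hsec.
  set (hv := h _ _ _) in *.
  replace (ddal t) with (- mu * dal t - kappa * dphi (kappa * t) * sin (al t)
    + kappa * dphi (kappa * t) * (sin (al t) - s) + s * (mu ^ 2 * e * Phi (kappa * t)))
    by (unfold ddal, dal; ring).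
  assert (HDexp : D * e = B * (A2 * C1) * e + 1 * (mu ^ 2 * e * B) + A2 * e
    + L * (A2 + A3) * e) by (unfold D; ring).
  lra.
Qed.

(** * A priori bounds and the vibrated pendulum *)

Lemma periodic_derivative (T : R) (f df : R -> R) :
  (forall t, is_derive f t (df t)) -> periodic T f -> periodic T df.
Proof.
intros Hd Hf t.
rewrite <- (is_derive_unique _ _ _ (Hd t)).
symmetry. apply is_derive_unique.
apply (is_derive_ext (fun s => f (s + T))); [exact Hf|].
apply is_derive_shift, Hd.
Qed.

Lemma lipschitz_on_periodic_box (T a b c d : R) (h : R -> R -> R -> R) :
  0 < T -> C_n3 1 h -> (forall x y, periodic T (h x y)) ->
  exists L : R, 0 <= L /\ forall x x' y y' z z' : R,
    a <= x <= b -> a <= x' <= b -> c <= y <= d -> c <= y' <= d ->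
    Rabs (h x' y' z' - h x y z)
    <= L * (Rabs (x' - x) + Rabs (y' - y) + Rabs (z' - z)).
Proof.
intros HT [_ [Hex [[Hc1 _] [[Hc2 _] [Hc3 _]]]]] Hper.
assert (Hdx : forall x y z, is_derive (fun u => h u y z) x (Derive (fun u => h u y z) x))
  by (intros x y z; exact (Derive_correct _ _ (proj1 (Hex x y z)))).
assert (Hdy : forall x y z, is_derive (fun u => h x u z) y (Derive (fun u => h x u z) y))
  by (intros x y z; exact (Derive_correct _ _ (proj1 (proj2 (Hex x y z))))).
assert (Hdz : forall x y z, is_derive (fun u => h x y u) z (Derive (fun u => h x y u) z))
  by (intros x y z; exact (Derive_correct _ _ (proj2 (proj2 (Hex x y z))))).
destruct (bounded_on_periodic_box T a b c d _ HT Hc1) as [M1 [HM1 HB1]].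
{ intros x y z. apply Derive_ext. intros u. apply Hper. }
destruct (bounded_on_periodic_box T a b c d _ HT Hc2) as [M2 [HM2 HB2]].
{ intros x y z. apply Derive_ext. intros u. apply Hper. }
destruct (bounded_on_periodic_box T a b c d _ HT Hc3) as [M3 [HM3 HB3]].
{ intros x y. apply (periodic_derivative T (h x y)); [apply Hdz | apply Hper]. }
exists (M1 + M2 + M3). split; [lra|].
intros x x' y y' z z' Hx Hx' Hy Hy'.
assert (E1 : Rabs (h x' y' z' - h x y' z') <= M1 * Rabs (x' - x)).
{ apply (lipschitz_of_derive_bound (fun u => h u y' z')
    (fun u => Derive (fun u => h u y' z') u)); intros u Hu; [apply Hdx|].
  apply HB1; [|exact Hy'].
  revert Hu. unfold Rmin, Rmax. destruct Rle_dec; lra. }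
assert (E2 : Rabs (h x y' z' - h x y z') <= M2 * Rabs (y' - y)).
{ apply (lipschitz_of_derive_bound (fun u => h x u z')
    (fun u => Derive (fun u => h x u z') u)); intros u Hu; [apply Hdy|].
  apply HB2; [exact Hx|].
  revert Hu. unfold Rmin, Rmax. destruct Rle_dec; lra. }
assert (E3 : Rabs (h x y z' - h x y z) <= M3 * Rabs (z' - z)).
{ apply (lipschitz_of_derive_bound (fun u => h x y u)
    (fun u => Derive (fun u => h x y u) u)); intros u Hu; [apply Hdz|].
  now apply HB3. }
replace (h x' y' z' - h x y z)
  with ((h x' y' z' - h x y' z') + (h x y' z' - h x y z') + (h x y z' - h x y z)) by ring.
assert (E := Rabs_plus_le _ _ _ _ (Rabs_plus_le _ _ _ _ E1 E2) E3).
eapply Rle_trans; [exact E|].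
generalize (Rabs_pos (x' - x)) (Rabs_pos (y' - y)) (Rabs_pos (z' - z)).
intros.
assert (forall m n u, 0 <= m -> 0 <= n -> 0 <= u -> 0 <= (m + n) * u)
  by (intros; apply Rmult_le_pos; lra).
assert (0 <= (M2 + M3) * Rabs (x' - x)) by auto.
assert (0 <= (M1 + M3) * Rabs (y' - y)) by auto.
assert (0 <= (M1 + M2) * Rabs (z' - z)) by auto.
lra.
Qed.

Lemma periodic_strict_upper_bound (T c : R) (f : R -> R) :
  0 < T -> (forall t, continuous f t) -> periodic T f -> (forall t, f t < c) ->
  exists eps : R, 0 < eps /\ forall t, f t <= c - eps.
Proof.
intros HT Hf Hper Hc.
destruct (continuity_ab_maj f 0 T) as [m [Hm _]]; [lra| |].
{ intros t _. apply continuity_pt_filterlim, Hf. }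
exists (c - f m). split; [generalize (Hc m); lra|].
intros t. destruct (period_reduction T t HT) as [n Hn].
rewrite <- (periodic_IZR T f n t Hper). generalize (Hm _ Hn). lra.
Qed.

Lemma pendulum_force_lipschitz (mu B L : R) (phi dphi : R -> R) (h : R -> R -> R -> R)
  (k : nat) :
  0 <= mu ->
  (forall t, Rabs (phi t) <= B) -> (forall t, Rabs (dphi t) <= B) ->
  (forall t t', Rabs (phi t' - phi t) <= B * Rabs (t' - t)) ->
  (forall t t', Rabs (dphi t' - dphi t) <= B * Rabs (t' - t)) ->
  lipschitz3 L h ->
  exists M : R, lipschitz3 M (pendulum_force mu phi dphi h k).
Proof.
intros Hmu Bphi Bdphi Lphi Ldphi Hh.
assert (HL := lipschitz3_nonneg L h Hh).
assert (HB : 0 <= B) by (eapply Rle_trans; [apply Rabs_pos | apply (Bphi 0)]).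
assert (Hk := pos_INR k). set (kappa := INR k) in *.
assert (Hprod : forall g : R -> R, (forall t, Rabs (g t) <= B) ->
  (forall t t', Rabs (g t' - g t) <= B * Rabs (t' - t)) ->
  forall t t' q q', Rabs (g (kappa * t') * sin q' - g (kappa * t) * sin q)
  <= B * (kappa * Rabs (t' - t)) + B * Rabs (q' - q)).
{ intros g Bg Lg t t' q q'.
  replace (g (kappa * t') * sin q' - g (kappa * t) * sin q)
    with ((g (kappa * t') - g (kappa * t)) * sin q' + g (kappa * t) * (sin q' - sin q)) by ring.
  apply Rabs_plus_le.
  - rewrite <- (Rmult_1_r (B * (kappa * Rabs (t' - t)))). apply Rabs_mult_le.
    + eapply Rle_trans; [apply Lg|].
      rewrite <- Rmult_minus_distr_l, Rabs_mult, (Rabs_right kappa) by lra. lra.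
    + apply Rabs_le. generalize (SIN_bound q'). lra.
  - apply Rabs_mult_le; [apply Bg | apply sin_lipschitz]. }
set (ct := kappa * (B * kappa) + L * (B * kappa + 1)).
set (cq := 1 + kappa * B + L * (1 + B)).
set (cv := mu + L).
exists (ct + cq + cv).
intros t t' q q' v v'. unfold pendulum_force. fold kappa.
assert (H1 := Hprod phi Bphi Lphi t t' q q').
assert (H2 := Hprod dphi Bdphi Ldphi t t' q q').
assert (H3 := sin_lipschitz q q').
assert (H4 := Hh q q' (v + phi (kappa * t) * sin q) (v' + phi (kappa * t') * sin q') t t').
set (s := phi (kappa * t) * sin q) in *. set (s' := phi (kappa * t') * sin q') in *.
set (ds := dphi (kappa * t) * sin q) in *. set (ds' := dphi (kappa * t') * sin q') in *.
set (hh := h q (v + s) t) in *. set (hh' := h q' (v' + s') t') in *.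
replace (- mu * v' - sin q' - kappa * dphi (kappa * t') * sin q' + hh' -
  (- mu * v - sin q - kappa * dphi (kappa * t) * sin q + hh))
  with (mu * - (v' - v) + - (sin q' - sin q) + kappa * - (ds' - ds) + (hh' - hh))
  by (unfold ds, ds'; ring).
assert (H5 : Rabs (v' + s' - (v + s)) <=
  Rabs (v' - v) + (B * (kappa * Rabs (t' - t)) + B * Rabs (q' - q))).
{ replace (v' + s' - (v + s)) with ((v' - v) + (s' - s)) by ring.
  apply Rabs_plus_le; [apply Rle_refl | exact H1]. }
assert (H6 : Rabs (hh' - hh) <= L * (Rabs (q' - q) + (Rabs (v' - v) +
  (B * (kappa * Rabs (t' - t)) + B * Rabs (q' - q))) + Rabs (t' - t))).
{ eapply Rle_trans; [exact H4|]. apply Rmult_le_compat_l; lra. }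
assert (H7 : Rabs (mu * - (v' - v)) <= mu * Rabs (v' - v)).
{ rewrite Rabs_mult, Rabs_Ropp, (Rabs_right mu); lra. }
assert (H8 : Rabs (kappa * - (ds' - ds)) <=
  kappa * (B * (kappa * Rabs (t' - t)) + B * Rabs (q' - q))).
{ rewrite Rabs_mult, Rabs_Ropp, (Rabs_right kappa) by lra.
  apply Rmult_le_compat_l; assumption. }
rewrite <- Rabs_Ropp in H3.
assert (H := Rabs_plus_le _ _ _ _ (Rabs_plus_le _ _ _ _ (Rabs_plus_le _ _ _ _ H7 H3) H8) H6).
eapply Rle_trans; [exact H|].
assert (Hct : 0 <= ct).
{ unfold ct. apply Rplus_le_le_0_compat; repeat apply Rmult_le_pos; try lra.
  apply Rplus_le_le_0_compat; [now apply Rmult_le_pos | lra]. }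
assert (Hcq : 0 <= cq).
{ unfold cq. assert (0 <= kappa * B) by now apply Rmult_le_pos.
  assert (0 <= L * (1 + B)) by (apply Rmult_le_pos; lra). lra. }
assert (Hcv : 0 <= cv) by (unfold cv; lra).
generalize (Rabs_pos (t' - t)) (Rabs_pos (q' - q)) (Rabs_pos (v' - v)).
set (x := Rabs (t' - t)). set (y := Rabs (q' - q)). set (z := Rabs (v' - v)).
intros Hx Hy Hz.
apply Rle_trans with (ct * x + cq * y + cv * z).
- right. unfold ct, cq, cv. ring.
- assert (0 <= ct * (y + z)) by (apply Rmult_le_pos; lra).
  assert (0 <= cq * (x + z)) by (apply Rmult_le_pos; lra).
  assert (0 <= cv * (x + y)) by (apply Rmult_le_pos; lra). lra.
Qed.

(** The velocity vanishes somewhere in each period, and v + mu q has a derivative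
bounded by M. The bound involves neither a Lipschitz constant nor the size of v,
so it applies to a truncated force and shows that the truncation is inactive. *)
Lemma periodic_velocity_bound (T mu lo hi M : R) (q v dv : R -> R) :
  0 < T -> 0 <= mu -> periodic T q ->
  (forall t, is_derive q t (v t)) -> (forall t, is_derive v t (dv t)) ->
  (forall t, Rabs (dv t + mu * v t) <= M) -> (forall t, lo <= q t <= hi) ->
  forall t, Rabs (v t) <= M * T + mu * (hi - lo).
Proof.
intros HT Hmu Hper Hq Hv HM Hb t.
assert (HM0 : 0 <= M) by (eapply Rle_trans; [apply Rabs_pos | apply (HM 0)]).
destruct (mean_value q v (t - T) t) as [c [Hc Hqc]]; [auto|].
rewrite Rmin_left, Rmax_right in Hc by lra.
assert (Hv0 : v c = 0).
{ assert (Hqt := Hper (t - T)). replace (t - T + T) with t in Hqt by ring.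
  rewrite Hqt, Rminus_diag in Hqc. symmetry in Hqc.
  apply Rmult_integral in Hqc. destruct Hqc as [H|H]; [exact H | lra]. }
assert (Hg : Rabs ((v t + mu * q t) - (v c + mu * q c)) <= M * Rabs (t - c)).
{ apply (lipschitz_of_derive_bound (fun s => v s + mu * q s) (fun s => dv s + mu * v s)).
  - intros s _. apply (is_derive_plus (V := R_NormedModule)); [apply Hv|].
    apply is_derive_scal, Hq.
  - intros s _. apply HM. }
assert (HMT : M * Rabs (t - c) <= M * T)
  by (apply Rmult_le_compat_l; [exact HM0 | apply Rabs_le; lra]).
replace (v t) with (((v t + mu * q t) - (v c + mu * q c)) + mu * (q c - q t))
  by (rewrite Hv0; ring).
apply Rabs_plus_le; [lra|].
apply Rabs_mult_le; [rewrite Rabs_right; lra|].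
apply Rabs_le. generalize (Hb c) (Hb t). lra.
Qed.

Theorem theorem2p1 (T mu : R) (phi : R -> R) (h : R -> R -> R -> R)
  (hT : 0 < T) (hmu : 0 <= mu)
  (phi_smooth : smooth phi)
  (phi_periodic : periodic T phi)
  (phi_average : is_RInt phi 0 T 0)
  (h_bounded : bounded3 h)
  (h_smooth : smooth3 h)
  (h_periodic : forall q p : R, periodic T (h q p))
  (h_left : forall t : R, h (PI / 2) 0 t < 1)
  (h_right : forall t : R, h (3 * PI / 2) 0 t > -1) :
  exists K : nat, forall k : nat, (K < k)%nat ->
    exists q p : R -> R,
      pendulum_solution mu phi h k q p /\
      periodic T q /\ periodic T p /\
      (forall t : R, PI / 2 < q t < 3 * PI / 2).
Proof.
assert (HPI := PI2_1).
set (dphi := Derive phi). set (ddphi := Derive dphi).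
assert (Dphi : forall t, is_derive phi t (dphi t))
  by (intros t; apply Derive_correct, (phi_smooth 1%nat t)).
assert (Ddphi : forall t, is_derive dphi t (ddphi t))
  by (intros t; apply Derive_correct, (phi_smooth 2%nat t)).
assert (Pdphi : periodic T dphi) by now apply (periodic_derivative T phi).
assert (Pddphi : periodic T ddphi) by now apply (periodic_derivative T dphi).
destruct (zero_mean_antiderivative T phi) as [Phi [DPhi [PPhi IPhi]]];
  [assumption | intros t; eapply continuous_of_is_derive, Dphi | assumption | assumption |].
destruct (zero_mean_antiderivative T Phi) as [Phi2 [DPhi2 [PPhi2 _]]];
  [assumption | intros t; eapply continuous_of_is_derive, DPhi | assumption | assumption |].
assert (HB : exists B, (forall t, Rabs (phi t) <= B) /\ (forall t, Rabs (dphi t) <= B) /\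
  (forall t, Rabs (ddphi t) <= B) /\ (forall t, Rabs (Phi t) <= B) /\
  (forall t, Rabs (Phi2 t) <= B)).
{ destruct (bounded_periodic T phi hT) as [B1 [HB1 HB1']];
    [intros t; eapply continuous_of_is_derive, Dphi | assumption |].
  destruct (bounded_periodic T dphi hT) as [B2 [HB2 HB2']];
    [intros t; eapply continuous_of_is_derive, Ddphi | assumption |].
  destruct (bounded_periodic T ddphi hT) as [B3 [HB3 HB3']];
    [intros t; apply (ex_derive_continuous (V := R_NormedModule)), (phi_smooth 3%nat t)
    | assumption |].
  destruct (bounded_periodic T Phi hT) as [B4 [HB4 HB4']];
    [intros t; eapply continuous_of_is_derive, DPhi | assumption |].
  destruct (bounded_periodic T Phi2 hT) as [B5 [HB5 HB5']];
    [intros t; eapply continuous_of_is_derive, DPhi2 | assumption |].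
  exists (B1 + B2 + B3 + B4 + B5).
  repeat split; intros t;
    generalize (HB1' t) (HB2' t) (HB3' t) (HB4' t) (HB5' t); lra. }
destruct HB as [B [Bphi [Bdphi [Bddphi [BPhi BPhi2]]]]].
assert (HB0 : 0 <= B) by (eapply Rle_trans; [apply Rabs_pos | apply (Bphi 0)]).
assert (Hcont : forall q p t, continuous (h q p) t).
{ intros q p t. destruct (h_smooth 1%nat) as [_ [Hex _]].
  apply (ex_derive_continuous (V := R_NormedModule)), (proj2 (proj2 (Hex q p t))). }
(* This Lipschitz constant determines K, so it must be taken on a box that does not
   depend on k. *)
destruct (lipschitz_on_periodic_box T 0 (2 * PI) (-1) 1 h hT (h_smooth 1%nat) h_periodic)
  as [L [HL HLip]].
destruct (periodic_strict_upper_bound T 1 (h (PI / 2) 0) hT) as [e1 [He1 Hl]];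
  [apply Hcont | apply h_periodic | apply h_left |].
destruct (oscillating_lower_solution T mu B e1 L phi dphi Phi Phi2 h) as [K1 HK1];
  try assumption.
{ intros q p t Hq Hp. apply Rabs_le_between in Hq. apply Rabs_le_between in Hp.
  assert (H : Rabs (h q p t - h (PI / 2) 0 t) <=
    L * (Rabs (q - PI / 2) + Rabs (p - 0) + Rabs (t - t))) by (apply HLip; lra).
  rewrite Rminus_diag, Rabs_R0, Rminus_0_r, Rplus_0_r in H.
  apply Rabs_le_between in H. generalize (Hl t). lra. }
(* The change of variables q -> 2 PI - q, p -> - p maps the system to the one
   with h replaced by - h (2 PI - q) (- p) t, so an upper solution near 3 PI / 2
   is the mirror image of a lower solution near PI / 2. *)
destruct (periodic_strict_upper_bound T 1 (fun t => - h (3 * PI / 2) 0 t) hT)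
  as [e2 [He2 Hr]].
{ intros t. apply (continuous_opp (V := R_NormedModule)), Hcont. }
{ intros t. now rewrite h_periodic. }
{ intros t. generalize (h_right t). lra. }
destruct (oscillating_lower_solution T mu B e2 L phi dphi Phi Phi2
  (fun q p t => - h (2 * PI - q) (- p) t)) as [K2 HK2]; try assumption.
{ intros q p t Hq Hp. assert (Hq' := Hq). assert (Hp' := Hp).
  apply Rabs_le_between in Hq'. apply Rabs_le_between in Hp'.
  assert (H : Rabs (h (2 * PI - q) (- p) t - h (3 * PI / 2) 0 t) <=
    L * (Rabs (2 * PI - q - 3 * PI / 2) + Rabs (- p - 0) + Rabs (t - t)))
    by (apply HLip; lra).
  replace (2 * PI - q - 3 * PI / 2) with (- (q - PI / 2)) in H by field.
  rewrite Rminus_diag, Rabs_R0, Rminus_0_r, Rplus_0_r, !Rabs_Ropp in H.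
  apply Rabs_le_between in H. generalize (Hr t). lra. }
exists (Nat.max K1 K2). intros k Hk.
destruct (HK1 k) as [al [dal [ddal [Pal [Pdal [Dal [Ddal [Bal [Bpal Hal]]]]]]]]]; [lia|].
destruct (HK2 k) as [ga [dga [ddga [Pga [Pdga [Dga [Ddga [Bga [Bpga Hga]]]]]]]]]; [lia|].
clear HK1 HK2 K1 K2 Hk HLip HL L.
destruct h_bounded as [Mh HMh].
assert (Hkpos := pos_INR k). set (kappa := INR k) in *.
assert (HMh0 : 0 <= Mh) by (eapply Rle_trans; [apply Rabs_pos | apply (HMh 0 0 0)]).
assert (HkB : 0 <= kappa * B) by now apply Rmult_le_pos.
(* A bound for the velocity of every periodic solution in the strip, independent
   of the level P at which h is truncated. *)
set (V := (1 + kappa * B + Mh) * T + mu * (3 * PI / 2 - PI / 2)).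
assert (HV : 0 <= V).
{ unfold V. apply Rplus_le_le_0_compat; apply Rmult_le_pos; lra. }
set (P := V + B + 1).
(* The truncation makes h globally Lipschitz and changes nothing on the region
   where the lower and upper solutions and the solution between them live. *)
set (hc := fun q p t => h (clamp 0 (2 * PI) q) (clamp (- P) P p) t).
destruct (lipschitz_on_periodic_box T 0 (2 * PI) (- P) P h hT (h_smooth 1%nat) h_periodic)
  as [L [HL HLip]].
assert (Hhc : lipschitz3 L hc).
{ intros q q' p p' t t'. unfold hc.
  eapply Rle_trans; [apply HLip; apply clamp_bounds; unfold P; lra|].
  apply Rmult_le_compat_l; [exact HL|].
  generalize (clamp_lipschitz 0 (2 * PI) q q') (clamp_lipschitz (- P) P p p'). lra. }
assert (Hhc_id : forall q p t, 0 <= q <= 2 * PI -> - P <= p <= P -> hc q p t = h q p t).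
{ intros q p t Hq Hp. unfold hc. now rewrite !clamp_id. }
destruct (pendulum_force_lipschitz mu B L phi dphi hc k) as [LF HLF]; try assumption.
{ intros t t'. apply (lipschitz_of_derive_bound phi dphi); auto. }
{ intros t t'. apply (lipschitz_of_derive_bound dphi ddphi); auto. }
assert (Hresc : forall f, periodic T f -> forall t, f (kappa * (t + T)) = f (kappa * t))
  by (intros f Hf; exact (periodic_rescale T f k Hf)).
destruct (periodic_between_lower_and_upper T LF (PI - 2)
  (pendulum_force mu phi dphi hc k) al dal ddal
  (fun t => 2 * PI - ga t) (fun t => - dga t) (fun t => - ddga t))
  as [q [v [Pq [Pv [Dq [Dv Hq]]]]]]; try assumption.
- intros t q v. unfold pendulum_force, hc. fold kappa.
  rewrite !Hresc by assumption. now rewrite h_periodic.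
- intros t. now rewrite Pga.
- intros t. now rewrite Pdga.
- intros t. replace (- dga t) with (0 - dga t) by ring.
  apply (is_derive_minus (V := R_NormedModule)); [|apply Dga].
  apply is_derive_Reals, derivable_pt_lim_const.
- intros t. apply (is_derive_opp (V := R_NormedModule)), Ddga.
- intros t. eapply Rle_trans; [|apply Hal]. right.
  unfold pendulum_force. fold kappa. f_equal. apply Hhc_id.
  + generalize (Bal t). lra.
  + assert (H := Bpal t). fold kappa in H. apply Rabs_le_between in H. unfold P. lra.
- intros t. apply Ropp_le_cancel. rewrite Ropp_involutive.
  eapply Rle_trans; [|apply Hga]. right.
  unfold pendulum_force. fold kappa.
  replace (sin (2 * PI - ga t)) with (- sin (ga t))
    by (rewrite sin_minus, sin_2PI, cos_2PI; ring).
  replace (- dga t + phi (kappa * t) * - sin (ga t))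
    with (- (dga t + phi (kappa * t) * sin (ga t))) by ring.
  rewrite Hhc_id; [ring | |].
  + generalize (Bga t). lra.
  + assert (H := Bpga t). fold kappa in H. apply Rabs_le_between in H. unfold P. lra.
- lra.
- intros t. generalize (Bal t) (Bga t). lra.
- assert (Hqb : forall t, PI / 2 < q t < 3 * PI / 2)
    by (intros t; generalize (Hq t) (Bal t) (Bga t); lra).
  assert (Hvb : forall t, Rabs (v t) <= V).
  { apply (periodic_velocity_bound T mu (PI / 2) (3 * PI / 2) (1 + kappa * B + Mh) q v
      (fun t => pendulum_force mu phi dphi hc k t (q t) (v t))); try assumption.
    - intros t. unfold pendulum_force. fold kappa.
      set (hv := hc _ _ _).
      replace (- mu * v t - sin (q t) - kappa * dphi (kappa * t) * sin (q t) + hv + mu * v t)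
        with (- sin (q t) + - (kappa * dphi (kappa * t) * sin (q t)) + hv) by ring.
      assert (Hs : Rabs (sin (q t)) <= 1)
        by (apply Rabs_le; generalize (SIN_bound (q t)); lra).
      apply Rabs_plus_le; [apply Rabs_plus_le|apply HMh]; rewrite Rabs_Ropp.
      + exact Hs.
      + rewrite <- (Rmult_1_r (kappa * B)).
        apply Rabs_mult_le; [|exact Hs]. apply Rabs_mult_le; [|apply Bdphi].
        rewrite Rabs_right; lra.
    - intros t. generalize (Hqb t). lra. }
  assert (Hphisin : forall t, Rabs (phi (kappa * t) * sin (q t)) <= B).
  { intros t. rewrite <- (Rmult_1_r B). apply Rabs_mult_le; [apply Bphi|].
    apply Rabs_le. generalize (SIN_bound (q t)). lra. }
  exists q, (fun t => v t + phi (kappa * t) * sin (q t)).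
  refine (conj (fun t => conj _ _) (conj Pq (conj _ Hqb))); fold kappa.
  + replace (_ - _) with (v t) by ring. apply Dq.
  + assert (D := is_derive_plus (V := R_NormedModule) _ _ t _ _ (Dv t)
      (is_derive_mult (fun t => phi (kappa * t)) (fun t => sin (q t)) t _ _
        (is_derive_rescale phi kappa t _ (Dphi (kappa * t)))
        (is_derive_comp sin q t _ _ (is_derive_sin (q t)) (Dq t)) Rmult_comm)).
    match type of D with is_derive _ _ ?l =>
      replace (_ + _) with l; [exact D|] end.
    unfold pendulum_force. fold kappa.
    rewrite Hhc_id.
    * unfold plus, mult, scal; simpl; unfold mult; simpl. rewrite sin_2a. field.
    * generalize (Hqb t). lra.
    * assert (H1 := Hvb t). assert (H2 := Hphisin t).
      apply Rabs_le_between in H1. apply Rabs_le_between in H2. unfold P. lra.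
  + intros t. now rewrite Pv, Pq, Hresc.
Qed.
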